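(* Min-VB-AM Probabilistic Lobbying (defined in the context) can be approximated in polynomial time within a factor of $\ln(N)+1$, where $N$ is the cover number of the given instance.
   Context: Probabilistic lobbying setting. There are $m$ voters $v_1,\dots,v_m$ and $n$ issues $r_1,\dots,r_n$. A probability matrix $P=(p_{i,j})\in(\mathbb{Q}\cap[0,1])^{m\times n}$ gives the probability that $v_i$ votes ''yes'' on $r_j$. A discretization level $k\in\mathbb{N}$ is chosen so that $k+1$ is a common multiple of the denominators of all $p_{i,j}$; admissible probability values are $0,\frac1{k+1},\dots,1$. For each $(i,j)$ a price function $c_{i,j}:\{0,\frac1{k+1},\dots,1\}\to\mathbb{N}$ with $c_{i,j}(p_{i,j})=0$, monotone in the sense that $p_{i,j}\le a\le b$ or $p_{i,j}\ge a\ge b$ implies $c_{i,j}(a)\le c_{i,j}(b)$, gives the price of changing $v_i$'s probability on $r_j$ to $a$; these form a cost matrix $C_P$. The Lobby has a target vector $\vec Z\in\{0,1\}^n$; a threshold $t\in\mathbb{Q}\cap[0,1]$ is given. Let $q_{i,j}$ be the probability that $v_i$ votes $Z_j$ ($p_{i,j}$ if $Z_j=1$, $1-p_{i,j}$ if $Z_j=0$) and $\bar q_j=\frac1m\sum_i q_{i,j}$. Average majority (AM): $r_j$ is won iff $\bar q_j>t$. Voter bribery: The Lobby chooses an amount $d_i\ge0$ per voter; $d_i$ is split equally among the $n$ issues, and for each $j$ the probability of $v_i$ on $r_j$ moves toward $Z_j$ to the farthest admissible value $a$ with $c_{i,j}(a)\le d_i/n$; its cost is $\sum_i d_i$. Min-VB-AM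 Probabilistic Lobbying: given $P,C_P,\vec Z$ (and $t$), find a voter bribery of minimum total cost making every issue won under AM. The cover number of issue $r_j$ is the least $c(r_j)\in\mathbb{N}$ with $\bar q_j+\frac{c(r_j)}{(k+1)m}>t$ (the number of single-level raises of voters' probabilities toward the agenda needed to win $r_j$), and the cover number of the instance is $N=\sum_{j=1}^n c(r_j)$. *)

(* Defs.v *)
From mathcomp Require Import all_boot all_order all_algebra.
From mathcomp Require Import reals.

Set Implicit Arguments.
Unset Strict Implicit.
Unset Printing Implicit Defensive.

Import Order.TTheory GRing.Theory Num.Theory.

(* Polynomial time is measured on a random access machine with logarithmic
   costs, written with structured control flow: every constant, address, operand
   and result occurring in a step is charged its number of binary digits.  This
   model and multitape Turing machines simulate each other with polynomial
   overhead. *)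

Definition bits (a : nat) : nat := (trunc_log 2 a).+1.

Definition memory := nat -> nat.

Inductive binop := Add | Sub | Mul | Div | Leq.

(* [Sub] is truncated, [Div] is the Euclidean quotient (0 when dividing by 0). *)
Definition binop_eval (o : binop) (a b : nat) : nat :=
  match o with
  | Add => a + b
  | Sub => a - b
  | Mul => a * b
  | Div => a %/ b
  | Leq => a <= b
  end.

Inductive expr :=
  | Const of nat
  | Read of expr
  | Bin of binop & expr & expr.

Fixpoint eval (M : memory) (e : expr) : nat :=
  match e with
  | Const a => a
  | Read e1 => M (eval M e1)
  | Bin o e1 e2 => binop_eval o (eval M e1) (eval M e2)
  end.

Fixpoint eval_time (M : memory) (e : expr) : nat :=
  match e with
  | Const a => bits a
  | Read e1 => eval_time M e1 + bits (eval M e1) + bits (eval M e)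
  | Bin o e1 e2 => eval_time M e1 + eval_time M e2
      + bits (eval M e1) + bits (eval M e2) + bits (eval M e)
  end.

(* [Write e1 e2] writes the value of [e2] at the address given by [e1]. *)
Inductive program :=
  | Skip
  | Write of expr & expr
  | Seq of program & program
  | If of expr & program & program
  | While of expr & program.

Definition update (M : memory) (x a : nat) : memory :=
  fun y => if y == x then a else M y.

(* [exec c M s M']: started in memory [M], the program [c] halts after time [s]
   in memory [M'].  A test succeeds when its value is nonzero. *)
Inductive exec : program -> memory -> nat -> memory -> Prop :=
  | ExecSkip M : exec Skip M 1 M
  | ExecWrite M e1 e2 :
      exec (Write e1 e2) M
        (eval_time M e1 + eval_time M e2
           + bits (eval M e1) + bits (eval M e2)).+1
        (update M (eval M e1) (eval M e2))
  | ExecSeq M M1 M2 c1 c2 s1 s2 :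
      exec c1 M s1 M1 -> exec c2 M1 s2 M2 ->
      exec (Seq c1 c2) M (s1 + s2).+1 M2
  | ExecIfTrue M M1 e c1 c2 s :
      eval M e <> 0 -> exec c1 M s M1 ->
      exec (If e c1 c2) M (eval_time M e + s).+1 M1
  | ExecIfFalse M M1 e c1 c2 s :
      eval M e = 0 -> exec c2 M s M1 ->
      exec (If e c1 c2) M (eval_time M e + s).+1 M1
  | ExecWhileTrue M M1 M2 e c s1 s2 :
      eval M e <> 0 -> exec c M s1 M1 -> exec (While e c) M1 s2 M2 ->
      exec (While e c) M (eval_time M e + s1 + s2).+1 M2
  | ExecWhileFalse M e c :
      eval M e = 0 -> exec (While e c) M (eval_time M e).+1 M.

Definition input_memory (w : seq nat) : memory := fun x => nth 0 w x.

Definition input_size (w : seq nat) : nat := \sum_(a <- w) bits a.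

Local Open Scope ring_scope.

(* The [a]-th admissible value at discretization level [k]. *)
Definition level_value (k : nat) (a : 'I_k.+2) : rat := a%:R / k.+1%:R.

Record instance := Instance {
  voters : nat;
  issues : nat;
  level : nat;
  prob : 'M[rat]_(voters, issues);
  (* [price i j a] is the price of the admissible value [level_value a]. *)
  price : 'I_voters -> 'I_issues -> 'I_level.+2 -> nat;
  target : 'I_issues -> bool;
  threshold : rat;
  voters_gt0 : (0 < voters)%N;
  issues_gt0 : (0 < issues)%N;
  prob_itv : forall i j, 0 <= prob i j <= 1;
  prob_denq : forall i j, (`|denq (prob i j)| %| level.+1)%N;
  price_prob : forall i j a, level_value a = prob i j -> price i j a = 0%N;
  price_mono : forall i j a b,
    (prob i j <= level_value a <= level_value b) ||
    (level_value b <= level_value a <= prob i j) ->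
    (price i j a <= price i j b)%N;
  threshold_itv : 0 <= threshold <= 1
}.

(* The price functions are given extensionally, as lists of [level + 2] values. *)
Definition encode (I : instance) : seq nat :=
  [:: voters I; issues I; level I;
      `|numq (threshold I)|%N; `|denq (threshold I)|%N]
  ++ [seq nat_of_bool (target j) | j <- enum 'I_(issues I)]
  ++ flatten [seq [:: `|numq (prob I i j)|%N, `|denq (prob I i j)|%N
                    & [seq price i j a | a <- enum 'I_(level I).+2]]
             | i <- enum 'I_(voters I), j <- enum 'I_(issues I)].

Definition agreement (I : instance) (Q : 'M[rat]_(voters I, issues I))
    (i : 'I_(voters I)) (j : 'I_(issues I)) : rat :=
  if target j then Q i j else 1 - Q i j.

Definition average (I : instance) (Q : 'M[rat]_(voters I, issues I))
    (j : 'I_(issues I)) : rat :=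
  (\sum_(i < voters I) agreement Q i j) / (voters I)%:R.

Definition won (I : instance) (Q : 'M[rat]_(voters I, issues I))
    (j : 'I_(issues I)) : bool :=
  threshold I < average Q j.

(* The value [prob I i j] is itself admissible and free, so starting the maximum
   (minimum) from it only discards values lying away from the target. *)
Definition bribed_prob (R : realType) (I : instance) (d : 'I_(voters I) -> R) :
    'M[rat]_(voters I, issues I) :=
  \matrix_(i, j)
    if target j then
      \big[Order.max/prob I i j]_(a | (price i j a)%:R <= d i / (issues I)%:R)
        level_value a
    else
      \big[Order.min/prob I i j]_(a | (price i j a)%:R <= d i / (issues I)%:R)
        level_value a.

Definition winning_bribery (R : realType) (I : instance)
    (d : 'I_(voters I) -> R) : Prop :=
  (forall i, 0 <= d i) /\ (forall j, won (bribed_prob d) j).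

Definition bribery_cost (R : realType) (I : instance)
    (d : 'I_(voters I) -> R) : R :=
  \sum_(i < voters I) d i.

Arguments winning_bribery {R} I d.
Arguments bribery_cost {R} I d.

(* The amounts are output as fractions of natural numbers. *)
Definition output_bribery (R : realType) (I : instance) (M : memory) :
    'I_(voters I) -> R :=
  fun i => (M i.*2)%:R / (M i.*2.+1)%:R.

Arguments output_bribery R I M : clear implicits.

Definition covered (I : instance) (j : 'I_(issues I)) (c : nat) : bool :=
  threshold I < average (prob I) j + c%:R / ((level I).+1 * voters I)%:R.

Lemma covered_ex (I : instance) (j : 'I_(issues I)) : exists c, covered j c.
Proof.
have m0 := voters_gt0 I.
exists (2 * ((level I).+1 * voters I))%N; rewrite /covered natrM mulfK; last first.
  by rewrite pnatr_eq0 muln_eq0 negb_or -!lt0n m0.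
have /andP[_ t1] := threshold_itv I.
apply: le_lt_trans t1 _; apply: (@lt_le_trans _ _ 2%:R) => //.
rewrite lerDr /average divr_ge0 ?ler0n// sumr_ge0// => i _.
rewrite /agreement; have /andP[p0 p1] := prob_itv i j.
by case: ifP; rewrite ?subr_ge0.
Qed.

Definition cover_number_issue (I : instance) (j : 'I_(issues I)) : nat :=
  ex_minn (covered_ex j).

Definition cover_number (I : instance) : nat :=
  (\sum_(j < issues I) cover_number_issue j)%N.

(* Main.v *)
Require Import Defs.
From mathcomp Require Import all_boot all_order all_algebra.
From mathcomp Require Import boolp reals exp.
From mathcomp Require Import zify ring lra.

(* Measured in admissible levels, the total agreement on an issue must reach a
   fixed quota K, and a budget b of a voter buys a number of levels that does
   not decrease with b.  Truncating the agreement on every issue at K and summing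
   over the issues gives a monotone potential, submodular in the vector of
   budgets, whose maximum characterizes the winning briberies.  The algorithm is
   the greedy one: it keeps raising the budget of one voter to some number
   occurring in the table, choosing the best ratio of gain in potential to
   expense.  If r is what the potential still lacks, submodularity makes this
   ratio at least r / OPT, so the total cost is at most OPT (1 + 1/2 + ... + 1/N). *)

Set Implicit Arguments.
Unset Strict Implicit.
Unset Printing Implicit Defensive.

Import Order.TTheory GRing.Theory Num.Theory.

(** * Running times *)

(** The cost is compared with that of an arbitrary winning bribery. Only the whole part of its
    [d i / issues I] matters against integral prices, and lowering this further to the largest entry
    of the voter's part of the table loses no level. So the competitor may be taken to be a vector
    of table entries, which the greedy candidates can match voter by voter.

    The logarithm arises by telescoping: a raise of gain g at deficit r costs at most OPT g / r,
    which is at most OPT (1/r + ... + 1/(r-g+1)).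

    Since prices are listed one by one, the table has more cells than there are (voter, level) pairs
    or units of potential to gain. Hence no loop, the rounds included, makes more passes than the
    input size. The remaining danger of logarithmic cost is long numbers: straight-line code may
    multiply lengths by a constant, which would explode under iteration. So each loop is described
    by explicit memory states, one per value of its counter, all below the same bound. *)

Definition bounded (W : nat) (M : memory) := forall x, M x < 2 ^ W.

(** The factor by which a value may be longer than the memory cells: a cell read has factor 1,
    whatever its address, and a sum or product is at most as long as its two operands together. *)
Fixpoint expr_size (e : expr) : nat :=
  match e with
  | Const a => bits a
  | Read _ => 1
  | Bin _ e1 e2 => expr_size e1 + expr_size e2
  end.

Fixpoint expr_time (e : expr) : nat :=
  match e with
  | Const a => bits a
  | Read e1 => expr_time e1 + expr_size e1 + 1
  | Bin _ e1 e2 => expr_time e1 + expr_time e2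
      + expr_size e1 + expr_size e2 + (expr_size e1 + expr_size e2)
  end.

Lemma ltn_bits a : a < 2 ^ bits a.
Proof. exact: trunc_log_ltn. Qed.

Lemma bits_leq a n : 0 < n -> a < 2 ^ n -> bits a <= n.
Proof.
case: a => [|a] n_gt0 a_lt; first by rewrite /bits trunc_log0.
rewrite /bits ltnNge; apply/negP => le_n.
by have := leq_trans (leq_pexp2l (isT : 0 < 2) le_n) (trunc_logP (isT : 1 < 2) (isT : 0 < a.+1));
  rewrite leqNgt a_lt.
Qed.

Lemma expr_size_gt0 e : 0 < expr_size e.
Proof. by elim: e => //= _ e1 IH1 e2 IH2; rewrite addn_gt0 IH1. Qed.

Lemma eval_ltn W M e : 0 < W -> bounded W M -> eval M e < 2 ^ (expr_size e * W).
Proof.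
move=> W_gt0 bM; elim: e => [a|e IH|o e1 IH1 e2 IH2] /=.
- by apply: leq_trans (ltn_bits a) _; rewrite leq_exp2l // leq_pmulr.
- by rewrite mul1n.
rewrite mulnDl expnD; set x1 := _ * W in IH1 *; set x2 := _ * W in IH2 *.
have x1_gt0 : 0 < x1 by rewrite muln_gt0 expr_size_gt0.
have x2_gt0 : 0 < x2 by rewrite muln_gt0 expr_size_gt0.
(* With both powers at least 2, their product also bounds a sum of the operands and the truth value
   1. *)
have p1 : 2 <= 2 ^ x1 by rewrite -[X in X <= _](expn1 2) leq_exp2l.
have p2 : 2 <= 2 ^ x2 by rewrite -[X in X <= _](expn1 2) leq_exp2l.
case: o => /=.
- nia.
- nia.
- exact: ltn_mul.
- by apply: leq_ltn_trans (leq_div _ _) _; nia.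
- by case: (eval M e1 <= eval M e2) => /=; nia.
Qed.

Lemma bits_eval W M e : 0 < W -> bounded W M -> bits (eval M e) <= expr_size e * W.
Proof.
by move=> W0 bM; apply: bits_leq (eval_ltn _ W0 bM); rewrite muln_gt0 expr_size_gt0.
Qed.

Lemma eval_time_leq W M e : 0 < W -> bounded W M -> eval_time M e <= expr_time e * W.
Proof.
move=> W0 bM; elim: e => [a|e IH|o e1 IH1 e2 IH2].
- by rewrite /= leq_pmulr.
- have := bits_eval e W0 bM; have := bits_eval (Read e) W0 bM.
  move=> /= b1 b2; rewrite !mulnDl; lia.
have := bits_eval e1 W0 bM; have := bits_eval e2 W0 bM.
have := bits_eval (Bin o e1 e2) W0 bM.
by move=> /= b1 b2 b3; rewrite !mulnDl in b1 *; lia.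
Qed.

Fixpoint straight (c : program) : bool :=
  match c with
  | Skip | Write _ _ => true
  | Seq c1 c2 | If _ c1 c2 => straight c1 && straight c2
  | While _ _ => false
  end.

(** A functional semantics for loop-free code, so that its effect can be computed by rewriting. *)
Fixpoint run (c : program) (M : memory) : memory :=
  match c with
  | Skip | While _ _ => M
  | Write e1 e2 => update M (eval M e1) (eval M e2)
  | Seq c1 c2 => run c2 (run c1 M)
  | If e c1 c2 => if eval M e != 0 then run c1 M else run c2 M
  end.

(* Running straight-line code multiplies the bit length of the memory by at most
   [growth c]. *)
Fixpoint growth (c : program) : nat :=
  match c with
  | Skip | While _ _ => 1
  | Write _ e2 => expr_size e2
  | Seq c1 c2 => growth c1 * growth c2
  | If _ c1 c2 => growth c1 + growth c2
  end.

Fixpoint straight_time (c : program) : nat :=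
  match c with
  | Skip | While _ _ => 1
  | Write e1 e2 => expr_time e1 + expr_time e2 + expr_size e1 + expr_size e2 + 1
  | Seq c1 c2 => straight_time c1 + growth c1 * straight_time c2 + 1
  | If e c1 c2 => expr_time e + straight_time c1 + straight_time c2 + 1
  end.

Definition runs (c : program) (M : memory) (T : nat) (M' : memory) :=
  exists2 s, exec c M s M' & s <= T.

Lemma growth_gt0 c : 0 < growth c.
Proof.
elim: c => //= [e1 e2|c1 h1 c2 h2|_ c1 h1 c2 h2]; first exact: expr_size_gt0.
- by rewrite muln_gt0 h1.
- by rewrite addn_gt0 h1.
Qed.

Lemma bounded_leq V W M : V <= W -> bounded V M -> bounded W M.
Proof. by move=> VW bM x; apply: leq_trans (bM x) _; rewrite leq_exp2l. Qed.

Lemma runs_straight W c M : straight c -> 0 < W -> bounded W M ->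
  runs c M (straight_time c * W) (run c M) /\ bounded (growth c * W) (run c M).
Proof.
elim: c W M => //= [|e1 e2|c1 IH1 c2 IH2|e c1 IH1 c2 IH2] W M.
- by move=> _ W0 bM; rewrite !mul1n; split => //; exists 1 => //; constructor.
- move=> _ W0 bM; split; last first.
    move=> x; rewrite /update; case: eqP => _; first exact: eval_ltn.
    by apply: bounded_leq bM x; rewrite leq_pmull // expr_size_gt0.
  eexists; first by constructor.
  have := bits_eval e1 W0 bM; have := bits_eval e2 W0 bM.
  have := eval_time_leq e1 W0 bM; have := eval_time_leq e2 W0 bM.
  by rewrite !mulnDl; lia.
- case/andP=> s1 s2 W0 bM; have [[t1 r1 l1] b1] := IH1 W M s1 W0 bM.
  have gW : 0 < growth c1 * W by rewrite muln_gt0 growth_gt0.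
  have [[t2 r2 l2] b2] := IH2 _ _ s2 gW b1.
  split; last by rewrite -mulnA mulnCA.
  exists (t1 + t2).+1; first exact: ExecSeq r1 r2.
  by rewrite mulnCA in l2; rewrite !mulnDl -mulnA; lia.
- case/andP=> s1 s2 W0 bM; have := eval_time_leq e W0 bM => et.
  case: eqP => [e0|e0] /=.
  + have [[t2 r2 l2] b2] := IH2 _ _ s2 W0 bM.
    split; last by apply: bounded_leq b2; rewrite leq_mul2r leq_addl orbT.
    by eexists; [apply: ExecIfFalse e0 r2 | rewrite !mulnDl; lia].
  + have [[t2 r2 l2] b2] := IH1 _ _ s1 W0 bM.
    split; last by apply: bounded_leq b2; rewrite leq_mul2r leq_addr orbT.
    by eexists; [apply: ExecIfTrue e0 r2 | rewrite !mulnDl; lia].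
Qed.

Lemma runs_code W c M M' : straight c -> 0 < W -> bounded W M -> run c M = M' ->
  runs c M (straight_time c * W) M'.
Proof. by move=> sc W0 bM <-; case: (runs_straight sc W0 bM). Qed.

Lemma runs_seq c1 c2 M M1 M2 T1 T2 :
  runs c1 M T1 M1 -> runs c2 M1 T2 M2 -> runs (Seq c1 c2) M (T1 + T2 + 1) M2.
Proof.
move=> [s1 r1 l1] [s2 r2 l2]; exists (s1 + s2).+1; first exact: ExecSeq r1 r2.
by lia.
Qed.

Definition loop_time (W T : nat) (e : expr) (Y : nat) :=
  Y * (expr_time e * W + T + 1) + (expr_time e * W + 1).

(** [St y] is the memory with [y] passes left, a number that the test itself evaluates to. The time
    is stated with [S] in place of [Y], so that it depends on the input size only. *)
Lemma runs_while (St : nat -> memory) W e c T Y S : 0 < W -> Y <= S ->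
  (forall y, y <= Y -> bounded W (St y) /\ eval (St y) e = y) ->
  (forall y, y < Y -> runs c (St y.+1) T (St y)) ->
  runs (While e c) (St Y) (loop_time W T e S) (St 0).
Proof.
move=> W0 YS hS hc.
suff [s r l] : runs (While e c) (St Y) (loop_time W T e Y) (St 0).
  by exists s => //; apply: leq_trans l _; rewrite /loop_time leq_add2r leq_mul2r YS orbT.
elim: Y {YS} hS hc => [|Y IH] hS hc.
  have [b0 e0] := hS 0 isT; eexists; first exact: ExecWhileFalse.
  by rewrite /loop_time mul0n addn1; have := eval_time_leq e W0 b0.
have [b1 e1] := hS Y.+1 (leqnn _).
have [s1 r1 l1] := hc Y (leqnn _).
have [||s2 r2 l2] := IH.
- by move=> y yY; apply: hS; apply: leqW.
- by move=> y yY; apply: hc; apply: leqW.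
eexists; first by apply: ExecWhileTrue r1 r2; rewrite e1.
by have := eval_time_leq e W0 b1; rewrite /loop_time in l2 *; rewrite mulSn; lia.
Qed.

(** * Polynomially bounded functions *)

Definition poly_bounded (f : nat -> nat) :=
  exists A e, forall s, 0 < s -> f s <= A * s ^ e.

Lemma poly_bounded_const a : poly_bounded (fun=> a).
Proof. by exists a, 0 => s _; rewrite muln1. Qed.

Lemma poly_bounded_id : poly_bounded id.
Proof. by exists 1, 1 => s _; rewrite mul1n. Qed.

Lemma poly_boundedD f g : poly_bounded f -> poly_bounded g ->
  poly_bounded (fun s => f s + g s).
Proof.
move=> [A [a hf]] [B [b hg]]; exists (A + B), (maxn a b) => s s0.
rewrite mulnDl leq_add //.
- by apply: leq_trans (hf s s0) _; rewrite leq_mul2l leq_pexp2l ?leq_maxl ?orbT.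
- by apply: leq_trans (hg s s0) _; rewrite leq_mul2l leq_pexp2l ?leq_maxr ?orbT.
Qed.

Lemma poly_boundedM f g : poly_bounded f -> poly_bounded g ->
  poly_bounded (fun s => f s * g s).
Proof.
move=> [A [a hf]] [B [b hg]]; exists (A * B), (a + b) => s s0.
by rewrite expnD mulnACA leq_mul ?hf ?hg.
Qed.

Lemma poly_bounded_loop_time W T e : poly_bounded W -> poly_bounded T ->
  poly_bounded (fun s => loop_time (W s) (T s) e s).
Proof.
move=> hW hT.
have hc := poly_bounded_const; have hM := poly_boundedM; have hD := poly_boundedD.
by rewrite /loop_time; apply: (hD); [apply: (hM);
  [exact: poly_bounded_id | do 2![apply: (hD) => //]; apply: (hM)] |
  apply: (hD) => //; apply: (hM)].
Qed.

(** * Greedy covering *)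

(** Truncation at [K] is concave, so the increments it lets through are subadditive. This is the
    submodularity behind the greedy bound. *)
Lemma leq_sum_minn_sub (I : Type) (r : seq I) (K H : nat) (F : I -> nat) :
  minn K (H + \sum_(i <- r) F i) - minn K H <= \sum_(i <- r) (minn K (H + F i) - minn K H).
Proof.
elim: r => [|i r IH]; first by rewrite !big_nil addn0 subnn.
rewrite !big_cons; move: (\sum_(j <- r) F j) (\sum_(j <- r) _) IH => a b; lia.
Qed.

Lemma leq_sum_sub (I : Type) (r : seq I) (P : pred I) (F G : I -> nat) :
  \sum_(i <- r | P i) F i - \sum_(i <- r | P i) G i <= \sum_(i <- r | P i) (F i - G i).
Proof.
rewrite leq_subLR -big_split /=; apply: leq_sum => i _; lia.
Qed.

Section Greedy.

Variables (m n K : nat) (h : nat -> nat -> nat -> nat).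
Hypothesis h_mono : forall i j, {homo h i j : a b / a <= b}.
Variables (X : nat) (voter amount : nat -> nat).

Definition reached (b : nat -> nat) (j : nat) : nat := \sum_(i < m) h i j (b i).

Definition potential (b : nat -> nat) : nat := \sum_(j < n) minn K (reached b j).

Definition raise (b : nat -> nat) (x : nat) : nat -> nat :=
  update b (voter x) (maxn (b (voter x)) (amount x)).

Definition gain (b : nat -> nat) (x : nat) : nat :=
  \sum_(j < n) (minn K (reached (raise b x) j) - minn K (reached b j)).

Definition expense (b : nat -> nat) (x : nat) : nat := amount x - b (voter x).

(* [t] is the gain, expense and cell of a raise.  A raise of expense 0 has gain 0,
   so the cross-multiplied comparison never selects it. *)
Definition improve (b : nat -> nat) (x : nat) (t : nat * nat * nat) :=
  if t.1.1 * expense b x < gain b x * t.1.2 then (gain b x, expense b x, x) else t.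

(** The initial triple has ratio 0 / 1, whose positive denominator makes cross-multiplication sound.
    Folding from the right visits the cells downwards, as the program does, and [y] is the last cell
    visited. *)
Definition best (b : nat -> nat) (y : nat) : nat * nat * nat :=
  foldr (improve b) (0, 1, 0) (index_iota y X).

Definition greedy_step (b : nat -> nat) : nat -> nat :=
  let t := best b 0 in
  if t.1.1 != 0 then update b (voter t.2) (amount t.2) else b.

Definition deficit (b : nat -> nat) : nat := n * K - potential b.

Lemma potential_leq b : potential b <= n * K.
Proof.
rewrite -[n in n * K]card_ord -sum_nat_const; apply: leq_sum => j _.
exact: geq_minl.
Qed.

Lemma reached_mono (b b' : nat -> nat) j :
  (forall i, b i <= b' i) -> reached b j <= reached b' j.
Proof. by move=> bb'; apply: leq_sum => i _; apply: h_mono. Qed.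

Lemma raise_geq b x i : b i <= raise b x i.
Proof. by rewrite /raise /update; case: eqP => // ->; rewrite leq_maxl. Qed.

Lemma potential_raise b x : potential (raise b x) = potential b + gain b x.
Proof.
rewrite /potential /gain -big_split /=; apply: eq_bigr => j _.
by have := reached_mono j (raise_geq b x); lia.
Qed.

Lemma gain_eq0 b x : expense b x = 0 -> gain b x = 0.
Proof.
rewrite /expense => e0; rewrite /gain big1 // => j _.
apply/eqP; rewrite subn_eq0 leq_min geq_minl (leq_trans (geq_minr _ _)) //.
apply: reached_mono => i; rewrite /raise /update; case: eqP => [->|//]; lia.
Qed.

Lemma bestP b y : let t := best b y in
  [/\ 0 < t.1.2,
      forall x, y <= x < X -> gain b x * t.1.2 <= t.1.1 * expense b x
    & t.1.1 != 0 -> t.2 < X /\ t = (gain b t.2, expense b t.2, t.2)].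
Proof.
have [d yd] : exists d, X - y = d by exists (X - y).
elim: d y yd => [|d IH] y yd.
  rewrite /best /index_iota yd /=; split => // x; lia.
have yX : y < X by lia.
have/IH[] : X - y.+1 = d by lia.
rewrite /best /index_iota yd (_ : X - y.+1 = d) /=; last by lia.
set t := foldr _ _ _ => c0 tmax tP; rewrite /improve.
have [lt_t|lt_t] /= := ltnP (t.1.1 * expense b y) (gain b y * t.1.2).
- have e0 : 0 < expense b y.
    by rewrite lt0n; apply/eqP => ex0; move: lt_t; rewrite gain_eq0 // mul0n ltn0.
  split => //= x /andP[]; rewrite leq_eqVlt => /orP[/eqP<-//|yx] xX.
  have := tmax x; rewrite yx xX => /(_ isT) lex.
  (* Transitivity of the comparison of ratios, passing through [t]: its positive expense is
     cancelled. *)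
  by rewrite -(leq_pmul2l c0); nia.
- split => // x /andP[].
  by rewrite leq_eqVlt => /orP[/eqP<-//|yx] xX; apply: tmax; rewrite yx.
Qed.

(** * Progress of the greedy algorithm against a covering vector of table entries *)

Section Progress.

Variables (B : nat -> nat).
Hypothesis B_cover : potential B = n * K.
Hypothesis voter_ltn : forall x, x < X -> voter x < m.
Hypothesis B_amount : forall i, i < m ->
  B i = 0 \/ exists x, [/\ x < X, voter x = i & amount x = B i].

Lemma reached_raise b x j : x < X ->
  reached (raise b x) j =
  reached b j + (h (voter x) j (maxn (b (voter x)) (amount x)) - h (voter x) j (b (voter x))).
Proof.
move=> xX; rewrite /reached (bigD1 (Ordinal (voter_ltn xX))) //=.
rewrite [in RHS](bigD1 (Ordinal (voter_ltn xX))) //= /raise /update eqxx.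
rewrite (eq_bigr (fun i : 'I_m => h i j (b i))); last first.
  by move=> i /eqP ne; case: eqP => // e; case: ne; apply: val_inj.
by have := @h_mono (voter x) j _ _ (leq_maxl (b (voter x)) (amount x)); lia.
Qed.

(** An averaging argument. Raising every voter to the maximum of [b] and [B] covers everything, so
    by subadditivity the separate raises gain at least the deficit in total. Each of them is a
    candidate or trivial, costs at most [B i], and has a ratio no better than that of [t]. *)
Lemma deficit_best b (t := best b 0) :
  deficit b * t.1.2 <= t.1.1 * \sum_(i < m) B i.
Proof.
have [c0 tmax _] := bestP b 0; rewrite -/t in c0 tmax.
pose b' i := maxn (b i) (B i).
have nK : n * K <= potential b'.
  rewrite -B_cover; apply: leq_sum => j _; rewrite leq_min geq_minl /=.
  apply: leq_trans (geq_minr _ _) _.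
  by apply: reached_mono => i; apply: leq_maxr.
pose gn i := \sum_(j < n)
  (minn K (reached b j + (h i j (b' i) - h i j (b i))) - minn K (reached b j)).
have le_gain : deficit b <= \sum_(i < m) gn i.
  apply: leq_trans (leq_sub2r _ nK) _; apply: leq_trans (leq_sum_sub _ _ _ _) _.
  rewrite exchange_big /=; apply: leq_sum => j _.
  apply: leq_trans (leq_sum_minn_sub _ _ _ _).
  rewrite leq_sub2r // leq_min geq_minl (leq_trans (geq_minr _ _)) //.
  rewrite /reached -big_split /=; apply: leq_sum => i _; lia.
apply: leq_trans (leq_mul le_gain (leqnn _)) _.
rewrite big_distrl big_distrr /=; apply: leq_sum => i _.
case: (B_amount (ltn_ord i)) => [Bi0|[x [xX vx ax]]].
  rewrite /gn /b' Bi0 maxn0 (eq_bigr (fun=> 0)) ?big1_eq //.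
  by move=> j _; rewrite subnn addn0 subnn.
have -> : gn i = gain b x.
  by apply: eq_bigr => j _; rewrite reached_raise // vx ax.
apply: leq_trans (tmax x xX) _; rewrite leq_mul2l /expense ax.
by rewrite leq_subr orbT.
Qed.

Lemma greedy_stepP b (t := best b 0) :
  [/\ deficit (greedy_step b) = deficit b - t.1.1,
      t.1.1 <= deficit b
    & (t.1.1 != 0 -> \sum_(i < m) greedy_step b i = \sum_(i < m) b i + t.1.2)].
Proof.
have [c0 _] := bestP b 0; rewrite /greedy_step -/t in c0 *.
case: (eqVneq t.1.1 0) => [->|g0 /(_ isT)[xX tE]]; first by rewrite subn0.
have [gE cE] : t.1.1 = gain b t.2 /\ t.1.2 = expense b t.2 by rewrite {1 3}tE.
(* The expense is positive, so the amount exceeds the current budget and is the maximum taken by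
   [raise]. *)
have up : update b (voter t.2) (amount t.2) = raise b t.2.
  by rewrite /raise; congr update; move: c0; rewrite cE /expense; lia.
have := potential_raise b t.2; have := potential_leq (raise b t.2).
rewrite /= up /deficit gE => lt1 eq1; split; [lia | lia |move=> _].
rewrite cE -up (bigD1 (Ordinal (voter_ltn xX))) //=.
rewrite [in RHS](bigD1 (Ordinal (voter_ltn xX))) //= /update eqxx.
rewrite (eq_bigr (fun i : 'I_m => b i)); last first.
  by move=> i /eqP ne; case: eqP => // e; case: ne; apply: val_inj.
by move: c0; rewrite cE /expense; lia.
Qed.

Local Open Scope ring_scope.

(** * Harmonic sums and the logarithm *)

Definition harmonic (R : realType) (r : nat) : R := \sum_(s < r) s.+1%:R^-1.

Lemma ler_harmonic (R : realType) (r s : nat) :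
  (r <= s)%N -> harmonic R r <= harmonic R s.
Proof.
move=> /subnKC <-; elim: (s - r)%N => [|d IH]; first by rewrite addn0.
by rewrite addnS [X in _ <= X]big_ord_recr /= (le_trans IH) // lerDl invr_ge0.
Qed.

(** The right side consists of [g] terms, from 1/r to 1/(r-g+1), each at least 1/r. *)
Lemma ler_harmonicB (R : realType) (r g : nat) : (g <= r)%N ->
  g%:R / r%:R <= harmonic R r - harmonic R (r - g).
Proof.
elim: g => [|g IH] gr; first by rewrite mul0r subn0 subrr.
rewrite -natr1 mulrDl mul1r.
have -> : harmonic R (r - g.+1) = harmonic R (r - g) - (r - g)%:R^-1.
  by rewrite -[(r - g)%N]prednK ?subn_gt0 // /harmonic big_ord_recr /= addrK subnS.
have r0 : (0 < r)%N := leq_ltn_trans (leq0n g) gr.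
have : r%:R^-1 <= (r - g)%:R^-1 :> R.
  by rewrite lef_pV2 ?posrE ?ltr0n ?subn_gt0 // ler_nat leq_subr.
by have := IH (ltnW gr); lra.
Qed.

(** Each new term 1/(N+2) is at most ln(N+2) - ln(N+1), by ln(1+x) <= x at x = -1/(N+2). *)
Lemma harmonic_ln (R : realType) (r N : nat) : (r <= N)%N -> harmonic R r <= ln N%:R + 1.
Proof.
move=> rN; apply: le_trans (ler_harmonic R rN) _; case: N {rN} => [|N].
  (* For [N = 0] the logarithm has the default value 0 and the sum is empty. *)
  by rewrite ln0 // add0r /harmonic big_ord0.
elim: N => [|N IH]; first by rewrite ln1 add0r /harmonic big_ord1 invr1.
have N2 : 0 < N.+2%:R :> R by rewrite ltr0n.
rewrite /harmonic big_ord_recr /= -/(harmonic R N.+1).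
have : ln (1 + - N.+2%:R^-1) <= - N.+2%:R^-1 :> R.
  by apply: le_ln1Dx; rewrite ltrN2 invf_lt1 // ltr1n.
have -> : 1 + - N.+2%:R^-1 = N.+1%:R / N.+2%:R :> R.
  move: N2; rewrite -[N.+2%:R]natr1; move: N.+1%:R => x /lt0r_neq0 x0.
  by field.
rewrite ln_div ?posrE ?ltr0n //.
by move: (ln _) (ln _) (harmonic R _) (N.+2%:R^-1) IH => a b c d; lra.
Qed.

Lemma greedy_cost (R : realType) (b0 := fun=> 0%N) (b := iter X greedy_step b0) :
  (potential B <= X)%N ->
  potential b = (n * K)%N /\
  (\sum_(i < m) b i)%:R <= (\sum_(i < m) B i)%:R * harmonic R (deficit b0).
Proof.
move=> BX; pose D : R := (\sum_(i < m) B i)%:R.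
(* A round either gains at least 1 or finds deficit 0, and the initial deficit is at most [n * K],
   which is [potential B]; so [X] rounds exhaust it. *)
have inv t : (deficit (iter t greedy_step b0) <= X - t)%N /\
    (\sum_(i < m) iter t greedy_step b0 i)%:R <=
      D * (harmonic R (deficit b0) - harmonic R (deficit (iter t greedy_step b0))).
  elim: t => [|t [IHd IHc]].
    by rewrite subn0 subrr mulr0 big1 // /deficit -B_cover; split=> //; lia.
  rewrite iterS; move: (iter t _ _) IHd IHc => c IHd IHc.
  have [dE g_le sumE] := greedy_stepP c.
  have stay : (best c 0).1.1 = 0%N -> greedy_step c = c.
    by rewrite /greedy_step => ->.
  have := deficit_best c; have [c0 _ _] := bestP c 0.
  move: (best c 0) c0 dE g_le sumE stay => t0 /= c0 dE g_le sumE stay rem.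
  have [g0|g_gt0] := posnP t0.1.1.
    (* By [deficit_best], a best gain of 0 leaves no room for a positive deficit: the algorithm
       cannot get stuck. *)
    have d0 : deficit c = 0%N by move: rem; rewrite g0 mul0n; nia.
    by rewrite (stay g0); split => //; rewrite d0.
  rewrite dE sumE -?lt0n // natrD; split; first lia.
  have d_gt0 : 0 < (deficit c)%:R :> R by rewrite ltr0n (leq_trans g_gt0).
  have : t0.1.2%:R <= D * (harmonic R (deficit c) - harmonic R (deficit c - t0.1.1)).
    apply: le_trans (ler_wpM2l (ler0n _ _) (ler_harmonicB R g_le)).
    by rewrite mulrA ler_pdivlMr // -!natrM ler_nat mulnC [X in (_ <= X)%N]mulnC.
  rewrite !mulrBr in IHc *; lra.
have [] := inv X; rewrite subnn leqn0 /deficit subn_eq0 => pX cX; split.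
  by apply/eqP; rewrite eqn_leq potential_leq.
apply: le_trans cX _; rewrite ler_wpM2l ?ler0n // lerBlDr lerDl.
by apply: sumr_ge0 => s _; rewrite invr_ge0.
Qed.

End Progress.
End Greedy.

(** * The price table *)

Section Table.
Variables (r : nat -> nat) (m n k : nat).

(** Five parameters and [n] target bits come first; a row then holds a numerator, a denominator and
    [k + 2] prices. *)
Definition entry (i j : nat) : nat := 5 + n + (i * n + j) * (k + 4).

(* A budget [b] per issue is enough to make voter [i] agree with the target on
   issue [j] at level [a]; the number of such levels is the agreement in units of
   [1 / k.+1]. *)
Definition hit (i j a b : nat) : bool :=
  let cheap := r (entry i j + 2 + a) <= b in
  if r (5 + j) != 0 then
    (0 < a) && ((a * r (entry i j).+1 <= r (entry i j) * k.+1) || cheap)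
  else (a <= k) && ((r (entry i j) * k.+1 <= a * r (entry i j).+1) || cheap).

Definition height (i j b : nat) : nat := \sum_(a < k.+2) hit i j a b.

(** Winning is strict: this is the least integer whose quotient by [k.+1 * m] exceeds the threshold
    [r 3 / r 4]. *)
Definition quota : nat := (r 3 * (k.+1 * m)) %/ r 4 + 1.

Definition cells : nat := m * n * (k + 4).

(* Every cell of the table is a candidate budget of its owner, including those
   that hold a numerator or a denominator: useless candidates are harmless. *)
Definition owner (x : nat) : nat := x %/ (n * (k + 4)).

Definition content (x : nat) : nat := r (5 + n + x).

Lemma hit_mono i j a : {homo hit i j a : b c / b <= c >-> b <= c}.
Proof.
move=> b c bc; rewrite /hit; set p := r (_ + a).
have : (p <= b) <= (p <= c) by case: (leqP p b) => // /leq_trans ->.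
move: (p <= b) (p <= c) => u v uv.
by case: ifP => _; [move: (0 < a) (a * _ <= _) | move: (a <= k) (_ <= a * _)];
  move=> [] []; case: u v uv => [] [].
Qed.

Lemma height_mono i j : {homo height i j : b c / b <= c}.
Proof. by move=> b c bc; apply: leq_sum => a _; apply: hit_mono. Qed.

(** This is what makes [cells] a sufficient number of rounds; it also bounds the gains kept in
    registers. *)
Lemma potential_height K b : potential m n K height b <= cells.
Proof.
have -> : cells = \sum_(j < n) m * (k + 4).
  by rewrite sum_nat_const card_ord /cells; ring.
apply: leq_sum => j _; apply: leq_trans (geq_minr _ _) _.
apply: (@leq_trans (\sum_(i < m) (k + 4))); last by rewrite sum_nat_const card_ord.
apply: leq_sum => i _; apply: (@leq_trans (\sum_(a < k.+2) 1)).
  by apply: leq_sum => a _; apply: leq_b1.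
by rewrite sum1_card card_ord; lia.
Qed.

End Table.

Lemma nth_flatten_uniform (T : Type) (x0 : T) (s : nat) (ss : seq (seq T)) q p :
  all (fun l => size l == s) ss -> p < s ->
  nth x0 (flatten ss) (q * s + p) = nth x0 (nth [::] ss q) p.
Proof.
elim: ss q => [|l ss IH] [|q] /= => [_ _|_ _|/andP[/eqP ls _] ps|/andP[/eqP ls hs] ps].
- by rewrite !nth_nil.
- by rewrite !nth_nil.
- by rewrite nth_cat mul0n ls ps.
- by rewrite nth_cat ls ltnNge mulSn -addnA leq_addr /= addKn IH.
Qed.

Lemma size_flatten_uniform (T : Type) (s : nat) (ss : seq (seq T)) :
  all (fun l => size l == s) ss -> size (flatten ss) = size ss * s.
Proof.
elim: ss => //= l ss IH /andP[/eqP ls /IH]; rewrite size_cat => ->; rewrite ls mulSn //.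
Qed.

(** * Reading the encoded instance; winning in terms of levels *)

Section Encode.
Variable I : instance.
Notation m := (voters I).
Notation n := (issues I).
Notation k := (level I).
Notation w := (encode I).

Let row (i : 'I_m) (j : 'I_n) :=
  [:: `|numq (prob I i j)|%N, `|denq (prob I i j)|%N & [seq price i j a | a <- enum 'I_k.+2]].

Lemma size_row i j : size (row i j) = k + 4.
Proof. by rewrite /= size_map size_enum_ord; lia. Qed.

Lemma nth_enum_map (T : Type) (x0 : T) (N : nat) (f : 'I_N -> T) (i : 'I_N) :
  nth x0 [seq f j | j <- enum 'I_N] i = f i.
Proof. by rewrite (nth_map i) ?size_enum_ord // nth_ord_enum. Qed.

Lemma rows_uniform :
  all (fun l => size l == k + 4) [seq row i j | i <- enum 'I_m, j <- enum 'I_n].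
Proof. by apply/allP => _ /allpairsP[[i j] [_ _ ->]]; rewrite size_row. Qed.

Lemma nth_rows (i : 'I_m) (j : 'I_n) :
  nth [::] [seq row i j | i <- enum 'I_m, j <- enum 'I_n] (i * n + j) = row i j.
Proof.
rewrite nth_flatten_uniform //.
  by rewrite (nth_enum_map [::] (fun i => [seq row i j | j <- enum 'I_n])) nth_enum_map.
by apply/allP => _ /mapP[i' _ ->]; rewrite size_map size_enum_ord.
Qed.

Lemma size_encode : size w = 5 + n + cells m n k.
Proof.
rewrite /encode !size_cat size_map size_enum_ord (size_flatten_uniform rows_uniform).
by rewrite size_allpairs !size_enum_ord /cells addnA.
Qed.

Lemma encode_target (j : 'I_n) : nth 0 w (5 + j) = target j.
Proof.
rewrite /encode nth_cat /= addKn nth_cat size_map size_enum_ord ltn_ord.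
by rewrite (nth_enum_map 0 (fun j => nat_of_bool (target j))).
Qed.

Lemma encode_entry (i : 'I_m) (j : 'I_n) p : p < k + 4 ->
  nth 0 w (entry n k i j + p) = nth 0 (row i j) p.
Proof.
move=> pk; rewrite /encode nth_cat /= /entry.
rewrite nth_cat size_map size_enum_ord ifN; last by lia.
rewrite (_ : _ - n = (i * n + j) * (k + 4) + p); last by lia.
by rewrite (nth_flatten_uniform _ _ rows_uniform) // nth_rows.
Qed.

Lemma encode_num (i : 'I_m) (j : 'I_n) : nth 0 w (entry n k i j) = `|numq (prob I i j)|%N.
Proof. by rewrite -[entry n k i j]addn0 encode_entry // addn_gt0 orbT. Qed.

Lemma encode_den (i : 'I_m) (j : 'I_n) : nth 0 w (entry n k i j).+1 = `|denq (prob I i j)|%N.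
Proof. by rewrite -addn1 encode_entry // addnC. Qed.

Lemma encode_price (i : 'I_m) (j : 'I_n) (a : 'I_k.+2) :
  nth 0 w (entry n k i j + 2 + a) = price i j a.
Proof.
rewrite -addnA encode_entry; last by have := ltn_ord a; lia.
by rewrite /= nth_enum_map.
Qed.

Local Open Scope ring_scope.

Lemma level_value_le (a b : 'I_k.+2) : (level_value a <= level_value b) = (a <= b)%N.
Proof. by rewrite /level_value ler_pM2r ?invr_gt0 ?ltr0n // ler_nat. Qed.

Lemma rat_natE (x : rat) : 0 <= x -> x = `|numq x|%N%:R / `|denq x|%N%:R.
Proof.
move=> x0.
by rewrite !natr_absz ger0_norm ?numq_ge0 // gtr0_norm ?denq_gt0 // divq_num_den.
Qed.

Lemma absz_denq_gt0 (x : rat) : (0 < `|denq x|)%N.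
Proof. by rewrite absz_gt0. Qed.

Lemma level_value_cmp i j (a : 'I_k.+2) :
  ((level_value a <= prob I i j) =
    (a * `|denq (prob I i j)| <= `|numq (prob I i j)| * k.+1)%N) *
  ((prob I i j <= level_value a) =
    (`|numq (prob I i j)| * k.+1 <= a * `|denq (prob I i j)|)%N).
Proof.
have /andP[p0 _] := prob_itv i j.
have := absz_denq_gt0 (prob I i j).
rewrite {2 5}[prob I i j]rat_natE // /level_value.
move: `|numq _|%N `|denq _|%N => x y y0.
split; rewrite ler_pdivrMr ?ltr0n // mulrAC ler_pdivlMr ?ltr0n // -!natrM ler_nat //.
Qed.

Lemma prob_level i j : exists a : 'I_k.+2, level_value a = prob I i j.
Proof.
have /andP[p0 p1] := prob_itv i j.
have [q kE] := dvdnP (prob_denq i j).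
have d0 := absz_denq_gt0 (prob I i j).
have q0 : (0 < q)%N by case: q kE.
move: p1; rewrite [prob I i j]rat_natE //.
move: kE d0; move: `|numq _|%N `|denq _|%N => x y kE d0.
rewrite ler_pdivrMr ?ltr0n // mul1r ler_nat => xy.
have xk : (x * q < k.+2)%N by rewrite ltnS kE mulnC leq_mul2l xy orbT.
exists (Ordinal xk); rewrite /level_value /= kE mulnC !natrM -mulf_div divff ?mul1r //.
by rewrite pnatr_eq0 -lt0n.
Qed.

Definition bribed_value (i : 'I_m) (j : 'I_n) (b : nat) : rat :=
  if target j then
    \big[Order.max/prob I i j]_(a : 'I_k.+2 | (price i j a <= b)%N) level_value a
  else \big[Order.min/prob I i j]_(a : 'I_k.+2 | (price i j a <= b)%N) level_value a.

Lemma big_extremum_attained (op : rat -> rat -> rat) (x : rat) (P : pred 'I_k.+2)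
    (F : 'I_k.+2 -> rat) : (forall y z, op y z = y \/ op y z = z) ->
  \big[op/x]_(a | P a) F a = x \/ exists2 a, P a & \big[op/x]_(a | P a) F a = F a.
Proof.
move=> sel; elim/big_rec: _ => [|a y Pa IH]; first by left.
by case: (sel (F a) y) => ->; [right; exists a|].
Qed.

Notation hitI := (hit (nth 0%N w) n k).
Notation heightI := (height (nth 0%N w) n k).

Lemma sum_initial N a : (a < N)%N -> (\sum_(x < N) ((0 < x) && (x <= a)) = a)%N.
Proof.
move=> aN; have -> : (\sum_(x < N) ((0 < x) && (x <= a)) = minn a N.-1)%N; last by lia.
elim: {aN} N => [|N IH]; first by rewrite big_ord0 minn0.
by rewrite big_ord_recr /= IH; case: ltnP; case: leqP => /=; lia.
Qed.

Lemma sum_final N a : (\sum_(x < N.+1) ((x < N) && (a <= x)) = N - a)%N.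
Proof.
have H M : (\sum_(x < M) ((x < N) && (a <= x)) = minn M N - a)%N.
  elim: M => [|M IH]; first by rewrite big_ord0; lia.
  by rewrite big_ord_recr /= IH; case: ltnP; case: leqP => /=; lia.
by rewrite H; lia.
Qed.

(** By monotonicity of prices, the levels that are hit form an interval ending at the bribed level:
    levels 1 to [a1] if the target is yes, [a1] to [k] if it is no. Leaving out the extreme level 0
    or [k.+1] makes their number equal to the agreement in level units. *)
Lemma height_bribed (i : 'I_m) (j : 'I_n) b :
  (heightI i j b)%:R =
  k.+1%:R * (if target j then bribed_value i j b else 1 - bribed_value i j b).
Proof.
have [a0 pE] := prob_level i j.
have sel_max (y z : rat) : Order.max y z = y \/ Order.max y z = z.
  by rewrite maxEle; case: ifP; [right|left].
have sel_min (y z : rat) : Order.min y z = y \/ Order.min y z = z.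
  by rewrite minEle; case: ifP; [left|right].
have k0 : k.+1%:R != 0 :> rat by rewrite pnatr_eq0.
rewrite /height /hit encode_target eqb0 negbK /bribed_value.
under eq_bigr => a _ do rewrite encode_num encode_den encode_price -!level_value_cmp.
case: (target j) => /=.
- set V := \big[Order.max/_]_(_ | _) _.
  have [a1 VE aP] : exists2 a1 : 'I_k.+2, V = level_value a1 &
      forall a : 'I_k.+2, (level_value a <= prob I i j) || (price i j a <= b)%N = (a <= a1)%N.
    have [a1 VE a1P] : exists2 a1 : 'I_k.+2, V = level_value a1 & a1 = a0 \/ (price i j a1 <= b)%N.
      case: (big_extremum_attained (prob I i j) (fun a => price i j a <= b)%N
               (@level_value k) sel_max) => [VE|[a1 Pa1 VE]].
      - by exists a0; [rewrite pE | left].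
      - by exists a1; [|right].
    exists a1 => // a; rewrite -level_value_le -VE; apply/idP/idP => [/orP[ap|ab]|aV].
    - by apply: le_trans ap _; apply: bigmax_ge_id.
    - exact: le_bigmax_cond.
    (* A level between the probability and [a1] is no dearer than [a1]; if [a1] is the probability
       itself, the level coincides with it and is free. *)
    - case: leP => //= /ltW pa; case: a1P => [a10|]; last first.
        by apply: leq_trans; apply: price_mono; rewrite pa -VE aV.
      by rewrite price_prob //; apply/le_anti; rewrite pa -pE -a10 -VE aV.
  rewrite VE /level_value mulrCA divff // mulr1; congr _%:R.
  rewrite -[RHS](sum_initial (ltn_ord a1)); apply: eq_bigr => a _.
  by rewrite aP.
- set V := \big[Order.min/_]_(_ | _) _.
  have [a1 VE aP] : exists2 a1 : 'I_k.+2, V = level_value a1 &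
      forall a : 'I_k.+2, (prob I i j <= level_value a) || (price i j a <= b)%N = (a1 <= a)%N.
    have [a1 VE a1P] : exists2 a1 : 'I_k.+2, V = level_value a1 & a1 = a0 \/ (price i j a1 <= b)%N.
      case: (big_extremum_attained (prob I i j) (fun a => price i j a <= b)%N
               (@level_value k) sel_min) => [VE|[a1 Pa1 VE]].
      - by exists a0; [rewrite pE | left].
      - by exists a1; [|right].
    exists a1 => // a; rewrite -level_value_le -VE; apply/idP/idP => [/orP[ap|ab]|aV].
    - by apply: le_trans ap; apply: bigmin_le_id.
    - exact: bigmin_le_cond.
    - case: leP => //= /ltW pa; case: a1P => [a10|]; last first.
        by apply: leq_trans; apply: price_mono; rewrite -VE aV pa orbT.
      by rewrite price_prob //; apply/le_anti; rewrite pa -pE -a10 -VE aV.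
  rewrite VE /level_value mulrBr mulr1 mulrCA divff // mulr1 -natrB -1?ltnS //; congr _%:R.
  rewrite -[RHS]sum_final; apply: eq_bigr => a _.
  by rewrite aP ltnS.
Qed.

Notation quotaI := (quota (nth 0%N w) m k).

Lemma threshold_quota s :
  (threshold I < s%:R / (k.+1 * m)%:R) = (quotaI <= s)%N.
Proof.
have /andP[t0 _] := threshold_itv I.
have km0 : (0 < k.+1 * m)%N by rewrite muln_gt0 voters_gt0.
have -> : quotaI = (`|numq (threshold I)| * (k.+1 * m) %/ `|denq (threshold I)| + 1)%N by [].
rewrite {1}[threshold I]rat_natE // addn1.
have := absz_denq_gt0 (threshold I); move: `|numq _|%N `|denq _|%N => x y y0.
rewrite ltn_divLR // ltr_pdivrMr ?ltr0n // mulrAC ltr_pdivlMr ?ltr0n //.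
by rewrite -!natrM ltr_nat.
Qed.

Lemma won_reached (Q : 'M[rat]_(m, n)) (b : nat -> nat) (j : 'I_n) :
  (forall i, Q i j = bribed_value i j (b i)) ->
  won Q j = (quotaI <= reached m heightI b j)%N.
Proof.
move=> QE; rewrite -threshold_quota /won /average; congr (_ < _).
have k0 : k.+1%:R != 0 :> rat by rewrite pnatr_eq0.
have m0 : m%:R != 0 :> rat by rewrite pnatr_eq0 -lt0n voters_gt0.
rewrite /reached natr_sum natrM.
under [in RHS]eq_bigr => i _ do rewrite height_bribed -QE.
by rewrite -mulr_sumr -mulf_div divff // mul1r.
Qed.

Lemma won_potential (b : nat -> nat) :
  (forall j : 'I_n, quotaI <= reached m heightI b j)%N <->
  potential m n quotaI heightI b = (n * quotaI)%N.
Proof.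
have nK : (\sum_(j < n) quotaI = n * quotaI)%N by rewrite sum_nat_const card_ord.
split=> [le_reached|].
  by rewrite -nK; apply: eq_bigr => j _; apply/minn_idPl.
move=> pE j; apply/minn_idPl.
move: pE; rewrite -nK /potential (bigD1 j) //= [in RHS](bigD1 j) //=.
have : (\sum_(i < n | i != j) minn quotaI (reached m heightI b i)
    <= \sum_(i < n | i != j) quotaI)%N.
  by apply: leq_sum => i _; apply: geq_minl.
have aux a c x y : (a <= x -> c <= y -> a + c = x + y -> a = x)%N by lia.
by apply: aux; apply: geq_minl.
Qed.

(** Cover numbers count from the given probabilities, while a budget of 0 may already buy further
    levels of price 0; hence only an inequality. *)
Lemma deficit_cover_number :
  (deficit m n quotaI heightI (fun=> 0) <= cover_number I)%N.
Proof.
have nK : (\sum_(j < n) quotaI = n * quotaI)%N by rewrite sum_nat_const card_ord.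
rewrite /deficit -nK; apply: leq_trans (leq_sum_sub _ _ _ _) _.
apply: leq_sum => j _; rewrite /cover_number_issue; case: ex_minnP => c cov _.
suff : (quotaI <= reached m heightI (fun=> 0) j + c)%N by lia.
rewrite -threshold_quota; apply: (lt_le_trans cov).
rewrite natrD mulrDl lerD2r /average /reached natr_sum natrM.
under [X in _ <= X / _]eq_bigr => i _ do rewrite height_bribed.
rewrite -mulr_sumr -mulf_div divff ?pnatr_eq0 // mul1r.
rewrite ler_pM2r ?invr_gt0 ?ltr0n ?voters_gt0 //; apply: ler_sum => i _.
rewrite /agreement /bribed_value; case: (target j); first exact: bigmax_ge_id.
by rewrite lerD2l lerN2 bigmin_le_id.
Qed.

Variable R : realType.

(** Real amounts enter only through comparisons with integral prices, so an integral budget per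
    issue can replace them. *)
Lemma bribed_probE (d : 'I_m -> R) (b : nat -> nat) i j :
  (forall p : nat, (p%:R <= d i / n%:R) = (p <= b i)%N) ->
  bribed_prob d i j = bribed_value i j (b i).
Proof.
move=> db; rewrite mxE /bribed_value; case: (target j); apply: eq_bigl => a; exact: db.
Qed.

Definition greedy_budgets : nat -> nat :=
  iter (cells m n k) (greedy_step m n quotaI heightI (cells m n k)
    (owner n k) (content (nth 0%N w) n)) (fun=> 0%N).

Lemma owner_ltn x : (x < cells m n k)%N -> (owner n k x < m)%N.
Proof.
rewrite /cells /owner -mulnA => xX; rewrite ltn_divLR //.
by rewrite muln_gt0 issues_gt0 addn_gt0 orbT.
Qed.

Lemma price_cell (i : 'I_m) (j : 'I_n) (a : 'I_k.+2) : exists x,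
  [/\ (x < cells m n k)%N, owner n k x = i & content (nth 0%N w) n x = price i j a].
Proof.
have p0 : (0 < n * (k + 4))%N by rewrite muln_gt0 issues_gt0 addn_gt0 orbT.
have qlt : (j * (k + 4) + (2 + a) < n * (k + 4))%N.
  have := ltn_ord a; have := leq_mul (ltn_ord j) (leqnn (k + 4)).
  by rewrite mulSn; lia.
have ow : owner n k (i * (n * (k + 4)) + (j * (k + 4) + (2 + a)))%N = i.
  by rewrite /owner divnMDl // divn_small // addn0.
exists (i * (n * (k + 4)) + (j * (k + 4) + (2 + a)))%N; split => //.
- rewrite /cells -mulnA; apply: leq_trans (leq_mul (ltn_ord i) (leqnn _)).
  by rewrite mulSn; lia.
- by rewrite /content -encode_price /entry; congr nth; ring.
Qed.

(** An amount is split among [n] issues, so a budget per issue is paid [n] times. This factor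
    appears on both sides, since [n * B i] is at most [d i]. *)
Lemma greedy_bribery (d : 'I_m -> R) (out := fun i : 'I_m => (n * greedy_budgets i)%:R) :
  winning_bribery I d ->
  winning_bribery I out /\
  bribery_cost I out <= (ln (cover_number I)%:R + 1) * bribery_cost I d.
Proof.
move=> [d0 dwon].
have n0 : 0 < n%:R :> R by rewrite ltr0n issues_gt0.
(* The greedy part indexes voters by natural numbers, so the whole parts are extended by 0. *)
pose f i := if insub i is Some i' then Num.truncn (d i' / n%:R) else 0%N.
have fE (i : 'I_m) : f i = Num.truncn (d i / n%:R).
  by rewrite /f insubT // => i_m; congr (Num.truncn (d _ / _)); apply: val_inj.
pose X := cells m n k.
pose r := nth 0%N w.
(* Every price of voter [i] is the content of one of its cells, so this rounding down affords the
   same levels as [f i]. *)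
pose B i := (\max_(x < X | (owner n k x == i) && (content r n x <= f i)) content r n x)%N.
have Bf i : (B i <= f i)%N by apply/bigmax_leqP => x /andP[].
have fB (i : 'I_m) (j : 'I_n) a : (price i j a <= f i)%N = (price i j a <= B i)%N.
  apply/idP/idP => [pf|/leq_trans]; last by apply.
  have [x [xX ox cx]] := price_cell i j a.
  rewrite -cx; apply: (leq_bigmax_cond (Ordinal xX)).
  by rewrite /= ox eqxx /r cx.
have wonB (j : 'I_n) : (quotaI <= reached m heightI B j)%N.
  have := dwon j; rewrite (won_reached (b := f)).
    rewrite (_ : reached _ _ B _ = reached m heightI f j) //.
    by apply: eq_bigr => i _; apply: eq_bigr => a _; rewrite /hit encode_price fB.
  by move=> i; apply: bribed_probE => p; rewrite fE truncn_ge_nat // divr_ge0 ?d0 ?ltW.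
have BX : (potential m n quotaI heightI B <= X)%N by apply: potential_height.
have B_amount i : (i < m)%N ->
    B i = 0%N \/ exists x, [/\ (x < X)%N, owner n k x = i & content r n x = B i].
  move=> _; rewrite /B; elim/big_rec: _ => [|x y /andP[/eqP ox _] IH]; first by left.
  rewrite /maxn; case: ifP => // _; right; exists x; split=> //; exact: ltn_ord.
have [gwon gcost] := @greedy_cost m n quotaI heightI (height_mono r n k) X (owner n k)
  (content r n) B ((won_potential B).1 wonB) owner_ltn B_amount R BX.
rewrite -/greedy_budgets in gwon gcost.
split; first split=> [i|j]; first by rewrite ler0n.
  rewrite (won_reached (b := greedy_budgets)); first exact: (won_potential _).2.
  move=> i; apply: bribed_probE => p.
  by rewrite ler_pdivlMr // -natrM ler_nat mulnC leq_pmul2l ?issues_gt0.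
rewrite /bribery_cost -natr_sum -big_distrr /= natrM.
have harm := harmonic_ln R deficit_cover_number.
have harm0 : 0 <= harmonic R (deficit m n quotaI heightI (fun=> 0%N)).
  by apply: sumr_ge0 => s _; rewrite invr_ge0.
apply: le_trans (ler_wpM2l (ltW n0) gcost) _; rewrite mulrA mulrC.
apply: (ler_pM harm0 _ harm); first by rewrite mulr_ge0 ?ler0n.
rewrite -natrM big_distrr /= natr_sum; apply: ler_sum => i _.
rewrite natrM mulrC -ler_pdivlMr //; apply: (@le_trans _ _ (f i)%:R); first by rewrite ler_nat.
by rewrite fE truncn_le divr_ge0 ?d0 ?ltW.
Qed.

End Encode.

(** * The program *)

Coercion Const : nat >-> expr.
Notation "a [+] b" := (Bin Add a b) (at level 50, left associativity).
Notation "a [-] b" := (Bin Defs.Sub a b) (at level 50, left associativity).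
Notation "a [*] b" := (Bin Mul a b) (at level 40, left associativity).
Notation "a [/] b" := (Bin Div a b) (at level 40, left associativity).
Notation "a [<=] b" := (Bin Leq a b) (at level 70, no associativity).
Notation "c ;; d" := (Seq c d) (at level 80, right associativity).

Definition get (v : nat) : expr := Read (Read 0 [+] v).
Definition put (v : nat) (e : expr) : program := Write (Read 0 [+] v) e.

Definition issues_e : expr := Read 1.
Definition level_e : expr := Read 2.
Definition budget_e (i : expr) : expr := Read (Read 0 [+] 12 [+] i).
Definition content_e (x : expr) : expr := Read (5 [+] issues_e [+] x).
Definition owner_e (x : expr) : expr := x [/] (issues_e [*] (level_e [+] 4)).
Definition expense_e (x : expr) : expr := content_e x [-] budget_e (owner_e x).
(** The two comparisons multiply to the indicator of [i] being the owner; adding the truncated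
    difference to the budget gives the maximum. *)
Definition raised_e (x i : expr) : expr :=
  budget_e i [+] (i [<=] owner_e x) [*] (owner_e x [<=] i) [*] (content_e x [-] budget_e i).
Definition entry_e (i j : expr) : expr :=
  5 [+] issues_e [+] (i [*] issues_e [+] j) [*] (level_e [+] 4).
(** Truth values are numbers: products are conjunctions, [1 [<=]] of a sum is a disjunction, and the
    two cases of the target are exclusive summands. *)
Definition hit_e (i j a b : expr) : expr :=
  let cheap := Read (entry_e i j [+] 2 [+] a) [<=] b in
  let yes := 1 [<=] Read (5 [+] j) in
  let num := Read (entry_e i j) [*] (level_e [+] 1) in
  let den := a [*] Read (entry_e i j [+] 1) in
  yes [*] (1 [<=] a) [*] (1 [<=] (den [<=] num) [+] cheap)
  [+] (1 [-] yes) [*] (a [<=] level_e) [*] (1 [<=] (num [<=] den) [+] cheap).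
Definition min_e (a b : expr) : expr := a [-] (a [-] b).

(* Registers: 0 number of voters, 1 quota, 2 rounds left, 3 current cell,
   4 current issue, 5 current (voter, level) pair, 6 and 7 agreement on the
   issue before and after the raise, 8 gain, and 9, 10, 11 gain, expense and
   cell of the best raise so far. *)
Definition pair_voter : expr := get 5 [/] (level_e [+] 2).
Definition pair_level : expr := get 5 [-] pair_voter [*] (level_e [+] 2).

Definition scan : program :=
  put 5 (get 5 [-] 1) ;;
  put 6 (get 6 [+] hit_e pair_voter (get 4) pair_level (budget_e pair_voter)) ;;
  put 7 (get 7 [+] hit_e pair_voter (get 4) pair_level (raised_e (get 3) pair_voter)).

Definition issue_start : program :=
  put 4 (get 4 [-] 1) ;; put 5 (get 0 [*] (level_e [+] 2)).
(** Scratch registers are cleared here and in the later [_end] pieces, so that the memory between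
    two passes has a simple closed form. *)
Definition issue_end : program :=
  put 8 (get 8 [+] (min_e (get 1) (get 7) [-] min_e (get 1) (get 6))) ;;
  put 6 0 ;; put 7 0.
Definition issue : program := issue_start ;; While (get 5) scan ;; issue_end.

Definition cell_start : program :=
  put 3 (get 3 [-] 1) ;; put 4 issues_e.
Definition cell_end : program :=
  If (get 9 [*] expense_e (get 3) [+] 1 [<=] get 8 [*] get 10)
    (put 9 (get 8) ;; put 10 (expense_e (get 3)) ;; put 11 (get 3)) Skip ;;
  put 8 0.
Definition cell : program := cell_start ;; While (get 4) issue ;; cell_end.

Definition cells_e : expr := get 0 [*] issues_e [*] (level_e [+] 4).

Definition round_start : program :=
  put 2 (get 2 [-] 1) ;; put 9 0 ;; put 10 1 ;; put 11 0 ;; put 3 cells_e.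
Definition round_end : program :=
  If (get 9) (Write (Read 0 [+] 12 [+] owner_e (get 11)) (content_e (get 11))) Skip ;;
  put 9 0 ;; put 10 0 ;; put 11 0.
Definition round : program := round_start ;; While (get 3) cell ;; round_end.

Definition length_e : expr :=
  5 [+] issues_e [+] Read 0 [*] issues_e [*] (level_e [+] 4).
(** The number of voters is saved in register 0, at the address [length_e], before cell 0 is
    overwritten with that base address. *)
Definition init : program :=
  Write length_e (Read 0) ;; Write 0 length_e ;;
  put 1 (Read 3 [*] ((level_e [+] 1) [*] get 0) [/] Read 4 [+] 1) ;;
  put 2 cells_e.

(** Once register 3 is lowered to i, voter i+1 is written to cells 2i+2 and 2i+3. Of the input, only
    cells 0 and 1 are still read at this stage; they belong to voter 0. *)
Definition output : program :=
  put 3 (get 3 [-] 1) ;;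
  Write (get 3 [+] get 3 [+] 3) 1 ;;
  Write (get 3 [+] get 3 [+] 2) (issues_e [*] budget_e (get 3 [+] 1)).
(* The first output cells hold the parameters, so they are written last. *)
Definition final : program :=
  Write 1 (issues_e [*] budget_e 0) ;; Write 0 (Read 1) ;; Write 1 1.

Definition main : program :=
  init ;; While (get 2) round ;; put 3 (get 0 [-] 1) ;; While (get 3) output ;; final.

Lemma eval_add M a b : eval M (a [+] b) = eval M a + eval M b. Proof. by []. Qed.
Lemma eval_sub M a b : eval M (a [-] b) = eval M a - eval M b. Proof. by []. Qed.
Lemma eval_mul M a b : eval M (a [*] b) = eval M a * eval M b. Proof. by []. Qed.
Lemma eval_div M a b : eval M (a [/] b) = eval M a %/ eval M b. Proof. by []. Qed.
Lemma eval_leq M a b : eval M (a [<=] b) = (eval M a <= eval M b). Proof. by []. Qed.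
Lemma eval_const M a : eval M (Const a) = a. Proof. by []. Qed.
Lemma eval_read M a : eval M (Read a) = M (eval M a). Proof. by []. Qed.
Definition evalE := (eval_add, eval_sub, eval_mul, eval_div, eval_leq, eval_const).
Lemma run_seq c d M : run (c ;; d) M = run d (run c M). Proof. by []. Qed.

(* At the boundaries of straight-line pieces all cells stay below [2 ^ (4 * s)],
   where [s] is the size of the input. *)
Definition code_time (c : program) (s : nat) : nat := straight_time c * (4 * s).
Definition scan_loop (s : nat) := loop_time (4 * s) (code_time scan s) (get 5) s.
Definition issue_time (s : nat) :=
  code_time issue_start s + (scan_loop s + code_time issue_end s + 1) + 1.
Definition issue_loop (s : nat) := loop_time (4 * s) (issue_time s) (get 4) s.
Definition cell_time (s : nat) :=
  code_time cell_start s + (issue_loop s + code_time cell_end s + 1) + 1.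
Definition cell_loop (s : nat) := loop_time (4 * s) (cell_time s) (get 3) s.
Definition round_time (s : nat) :=
  code_time round_start s + (cell_loop s + code_time round_end s + 1) + 1.
Definition round_loop (s : nat) := loop_time (4 * s) (round_time s) (get 2) s.
Definition output_loop (s : nat) := loop_time (4 * s) (code_time output s) (get 3) s.
Definition main_time (s : nat) :=
  code_time init s + (round_loop s + (code_time (put 3 (get 0 [-] 1)) s +
    (output_loop s + code_time final s + 1) + 1) + 1) + 1.

Lemma poly_bounded_main_time : poly_bounded main_time.
Proof.
have hD := poly_boundedD; have hc := poly_bounded_const.
have h4 : poly_bounded (fun s => 4 * s).
  exact: poly_boundedM (hc 4) poly_bounded_id.
have hcode c : poly_bounded (code_time c) by apply: poly_boundedM (hc _) h4.
have hl T e : poly_bounded T -> poly_bounded (fun s => loop_time (4 * s) (T s) e s).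
  exact: poly_bounded_loop_time.
have hscan : poly_bounded scan_loop by apply: hl.
have hissue : poly_bounded issue_loop by apply: hl; do ![apply: (hD) => //].
have hcell : poly_bounded cell_loop by apply: hl; do ![apply: (hD) => //].
have hround : poly_bounded round_loop by apply: hl; do ![apply: (hD) => //].
have hout : poly_bounded output_loop by apply: hl.
by do ![apply: (hD) => //].
Qed.

(** * Memory layout: input, registers, budgets *)

Section Layout.

Variable B : nat.
Hypothesis B_gt0 : 0 < B.

(* The output overwrites the input, so the registers and the budgets live behind
   the input, at the base address [B] kept in cell 0. *)
Definition layout (inp : nat -> nat) (vs : seq nat) (bs : nat -> nat) : memory :=
  fun x => if x == 0 then B else if x < B then inp x
    else if x < B + 12 then nth 0 vs (x - B) else bs (x - B - 12).

Lemma layout0 inp vs bs : layout inp vs bs 0 = B.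
Proof. by []. Qed.

Lemma layout_input inp vs bs x : 0 < x < B -> layout inp vs bs x = inp x.
Proof. by rewrite /layout => /andP[/gtn_eqF -> ->]. Qed.

Lemma layout_get inp vs bs v : v < 12 -> eval (layout inp vs bs) (get v) = nth 0 vs v.
Proof.
move=> v12; rewrite /= layout0 /layout addn_eq0 (gtn_eqF B_gt0) /=.
by rewrite ltnNge leq_addr /= ltn_add2l v12 addKn.
Qed.

Lemma layout_budget inp vs bs i :
  eval (layout inp vs bs) (budget_e i) = bs (eval (layout inp vs bs) i).
Proof.
rewrite /budget_e eval_read !evalE eval_read evalE layout0; set x := eval _ i.
rewrite /layout !addn_eq0 (gtn_eqF B_gt0) /= ifN ?ifN; first congr bs; lia.
Qed.

Lemma run_put inp vs bs v e : v < 12 ->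
  run (put v e) (layout inp vs bs) =
  layout inp (set_nth 0 vs v (eval (layout inp vs bs) e)) bs.
Proof.
move=> v12; have -> : run (put v e) (layout inp vs bs) =
  update (layout inp vs bs) (B + v) (eval (layout inp vs bs) e) by [].
move: (eval _ e) => a.
apply: funext => x; rewrite /layout /update; case: (eqVneq x (B + v)) => [->|ne].
  rewrite addn_eq0 (gtn_eqF B_gt0) /= ifN -?leqNgt ?leq_addr //.
  by rewrite ltn_add2l v12 addKn nth_set_nth /= eqxx.
case: ifP => // _; case: ltnP => // Bx; case: ifP => // _.
rewrite nth_set_nth /=; case: eqP => // xv; case/eqP: ne; lia.
Qed.

Lemma update_budget inp vs bs i a :
  update (layout inp vs bs) (B + 12 + i) a = layout inp vs (update bs i a).
Proof.
apply: funext => x; rewrite /layout /update; case: (eqVneq x (B + 12 + i)) => [->|ne].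
  rewrite (_ : B + 12 + i - B - 12 = i) ?eqxx; last by lia.
  by rewrite !ifN //; lia.
case: ifP => // _; case: ifP => // _; case: ltnP => // xB.
by case: eqP => // e; case/eqP: ne; lia.
Qed.

Lemma update_input inp vs bs x a : 0 < x < B ->
  update (layout inp vs bs) x a = layout (update inp x a) vs bs.
Proof.
move=> /andP[x0 xB]; apply: funext => y; rewrite /layout /update.
case: (eqVneq y x) => [->|//]; by rewrite (gtn_eqF x0) xB.
Qed.

Lemma bounded_layout W inp vs bs : B < 2 ^ W -> (forall x, inp x < 2 ^ W) ->
  all (fun v => v < 2 ^ W) vs -> (forall i, bs i < 2 ^ W) ->
  bounded W (layout inp vs bs).
Proof.
move=> hB hi hv hb x; rewrite /layout; case: eqP => // _; case: ifP => // _; case: ifP => // _.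
have [xv|xv] := ltnP (x - B) (size vs); first exact: (all_nthP 0 hv).
by rewrite nth_default ?expn_gt0.
Qed.

End Layout.

(** * Correctness and running time of the program *)

Section Correct.

Variables (m n k S : nat) (r : nat -> nat).
Hypotheses (m_gt0 : 0 < m) (n_gt0 : 0 < n).
Let B := 5 + n + cells m n k.
Hypotheses (r1 : r 1 = n) (r2 : r 2 = k).
Hypotheses (B_leq : B <= S) (r_ltn : forall x, r x < 2 ^ S).
Let W := 4 * S.

Notation lay := (layout B).

Let B_gt0 : 0 < B. Proof. by rewrite /B; lia. Qed.

Section Eval.
Variables (vs : seq nat) (bs : nat -> nat).
Let M := lay r vs bs.

Lemma eval_issues : eval M issues_e = n.
Proof. by rewrite /issues_e eval_read eval_const /M layout_input // /B; lia. Qed.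

Lemma eval_level : eval M level_e = k.
Proof. by rewrite /level_e eval_read eval_const /M layout_input // /B; lia. Qed.

Lemma eval_owner e : eval M (owner_e e) = owner n k (eval M e).
Proof. by rewrite /owner_e !evalE eval_issues eval_level. Qed.

Lemma eval_content e : eval M e < cells m n k ->
  eval M (content_e e) = content r n (eval M e).
Proof.
move=> e_lt; rewrite /content_e eval_read !evalE eval_issues /M layout_input //.
by rewrite -/M /B; lia.
Qed.

Lemma eval_expense e : eval M e < cells m n k ->
  eval M (expense_e e) = expense (owner n k) (content r n) bs (eval M e).
Proof.
by move=> e_lt; rewrite /expense_e evalE eval_content // layout_budget // eval_owner.
Qed.

Lemma eval_raised e i : eval M e < cells m n k ->
  eval M (raised_e e i) = raise (owner n k) (content r n) bs (eval M e) (eval M i).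
Proof.
move=> e_lt; rewrite /raised_e !evalE eval_content // eval_issues eval_level layout_budget //.
rewrite -/M -/(owner n k _) /raise /update; case: eqP => [->|ne]; first by rewrite leqnn; lia.
rewrite (_ : _ * _ = 0) ?addn0 //.
by case: leqP; case: leqP => /=; lia.
Qed.

Lemma eval_hit i j a b : eval M i < m -> eval M j < n -> eval M a < k.+2 ->
  eval M (hit_e i j a b) = hit r n k (eval M i) (eval M j) (eval M a) (eval M b).
Proof.
move=> im jn ak.
have M1 : M 1 = n := eval_issues.
have M2 : M 2 = k := eval_level.
rewrite /hit_e /entry_e /issues_e /level_e !(evalE, eval_read) M1 M2.
move: (eval M i) (eval M j) (eval M a) (eval M b) im jn ak => x y z c xm yn zk.
rewrite -/(entry n k x y) /M.
(* The whole row lies below the base address, so these reads see the input and not the registers. *)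
have lt_B : entry n k x y + (k + 4) <= B.
  rewrite /entry /B /cells -!addnA !leq_add2l.
  have := leq_mul (leq_mul xm (leqnn n)) (leqnn (k + 4)).
  rewrite mulSn => /(leq_trans _); apply; rewrite addnC -mulSn leq_mul2r.
  by apply/orP; right; lia.
have y_lt : 5 + y < B by rewrite /B; lia.
have p0 : 0 < entry n k x y by rewrite /entry; lia.
rewrite !layout_input; [|lia..].
rewrite !addn1 /hit -lt0n; case: posnP => _ /=.
  by rewrite mul0n add0n subn0 mul1n; case: (z <= k); case: (_ <= z * _); case: (_ <= c).
by rewrite subnn !mul0n addn0 mul1n; case: (0 < z); case: (z * _ <= _); case: (_ <= c).
Qed.
End Eval.

Lemma eval_pair_voter vs bs :
  eval (lay r vs bs) pair_voter = nth 0 vs 5 %/ k.+2.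
Proof. by rewrite /pair_voter eval_div layout_get // eval_add eval_level addn2. Qed.

Lemma eval_pair_level vs bs :
  eval (lay r vs bs) pair_level = nth 0 vs 5 - nth 0 vs 5 %/ k.+2 * k.+2.
Proof.
rewrite /pair_level eval_sub layout_get // eval_mul eval_pair_voter.
by rewrite eval_add eval_level addn2.
Qed.

Lemma eval_min inp vs bs a b : eval (lay inp vs bs) (min_e a b) =
  minn (eval (lay inp vs bs) a) (eval (lay inp vs bs) b).
Proof. by rewrite /min_e !eval_sub; lia. Qed.

Notation ow := (owner n k).
Notation ct := (content r n).
Notation X := (cells m n k).
Notation Y := (m * k.+2).
Notation ht := (height r n k).
Variable q : nat.
Notation top_raise := (best m n q ht X ow ct).
Notation raise_gain := (gain m n q ht ow ct).
Notation expense := (expense ow ct).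
Notation raise := (raise ow ct).
Notation reached := (reached m ht).
Notation table_step := (greedy_step m n q ht X ow ct).

(** The number [z] codes a (voter, level) pair by quotient and remainder modulo [k.+2], so a single
    loop computes the double sum. *)
Definition pair_hit (j : nat) (bs : nat -> nat) (z : nat) : nat :=
  hit r n k (z %/ k.+2) j (z - z %/ k.+2 * k.+2) (bs (z %/ k.+2)).

Lemma sum_pairs (F : nat -> nat -> nat) d N : 0 < d ->
  \sum_(0 <= z < N * d) F (z %/ d) (z - z %/ d * d) = \sum_(i < N) \sum_(a < d) F i a.
Proof.
move=> d0; elim: N => [|N IH]; first by rewrite mul0n big_geq // big_ord0.
rewrite mulSn addnC (big_cat_nat (n := N * d)) ?leq_addr //= IH big_ord_recr /=.
congr (_ + _); rewrite -{1}[N * d]add0n big_addn addKn big_mkord.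
apply: eq_bigr => a _; rewrite addnC divnMDl // divn_small // addn0.
by rewrite addKn.
Qed.

Lemma sum_pair_hit j bs : \sum_(0 <= z < Y) pair_hit j bs z = reached bs j.
Proof. exact: (sum_pairs (fun i a => hit r n k i j a (bs i))). Qed.

(** Counters descend, so with [y] pairs left the accumulators hold the sums over the indices from
    [y] on. *)
Definition scan_state T x j acc g c x' bs y : memory :=
  lay r [:: m; q; T; x; j; y; \sum_(y <= z < Y) pair_hit j bs z;
    \sum_(y <= z < Y) pair_hit j (raise bs x) z; acc; g; c; x'] bs.

Lemma run_scan T x j acc g c x' bs y : x < X -> j < n -> y < Y ->
  run scan (scan_state T x j acc g c x' bs y.+1) = scan_state T x j acc g c x' bs y.
Proof.
move=> xX jn yY; rewrite /scan_state /scan !run_seq.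
have y_div : y %/ k.+2 < m by rewrite ltn_divLR.
have y_mod : y - y %/ k.+2 * k.+2 < k.+2.
  by have := divn_eq y k.+2; have := ltn_pmod y (ltn0Sn k.+1); lia.
rewrite run_put // eval_sub layout_get // eval_const [nth _ _ _]/= subn1 [set_nth _ _ _ _]/=.
rewrite run_put // eval_add layout_get //.
rewrite eval_hit ?eval_pair_voter ?eval_pair_level ?layout_get //.
rewrite layout_budget // eval_pair_voter [set_nth _ _ _ _]/=.
rewrite run_put // eval_add layout_get //.
rewrite eval_hit ?eval_pair_voter ?eval_pair_level ?layout_get //.
rewrite eval_raised ?layout_get // eval_pair_voter [set_nth _ _ _ _]/=.
by rewrite !(big_ltn yY) ![pair_hit _ _ y + _]addnC.
Qed.


Definition issue_state T x g c x' bs j : memory :=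
  lay r [:: m; q; T; x; j; 0; 0; 0;
    \sum_(j <= i < n) (minn q (reached (raise bs x) i) - minn q (reached bs i));
    g; c; x'] bs.

Lemma run_issue_start T x g c x' bs j : j < n ->
  run issue_start (issue_state T x g c x' bs j.+1) =
  scan_state T x j (\sum_(j.+1 <= i < n)
    (minn q (reached (raise bs x) i) - minn q (reached bs i))) g c x' bs Y.
Proof.
move=> jn; rewrite /issue_state /scan_state /issue_start !run_seq.
rewrite run_put // eval_sub layout_get // eval_const [nth _ _ _]/= subn1 [set_nth _ _ _ _]/=.
rewrite run_put // eval_mul layout_get // eval_add eval_level eval_const addn2.
by rewrite [set_nth _ _ _ _]/= !(big_geq (leqnn Y)).
Qed.

Lemma run_issue_end T x g c x' bs j : j < n ->
  run issue_end (scan_state T x j (\sum_(j.+1 <= i < n)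
    (minn q (reached (raise bs x) i) - minn q (reached bs i))) g c x' bs 0) =
  issue_state T x g c x' bs j.
Proof.
move=> jn; rewrite /issue_state /scan_state /issue_end !run_seq !sum_pair_hit.
rewrite run_put // eval_add layout_get // eval_sub !eval_min !layout_get // [set_nth _ _ _ _]/=.
by rewrite !run_put // [set_nth _ _ _ _]/= (big_ltn jn) addnC.
Qed.

Definition cell_state T bs x : memory :=
  lay r [:: m; q; T; x; 0; 0; 0; 0; 0;
    (top_raise bs x).1.1; (top_raise bs x).1.2; (top_raise bs x).2] bs.

Lemma run_cell_start T bs x : x < X ->
  run cell_start (cell_state T bs x.+1) =
  issue_state T x (top_raise bs x.+1).1.1 (top_raise bs x.+1).1.2 (top_raise bs x.+1).2 bs n.
Proof.
move=> xX; rewrite /cell_state /issue_state /cell_start run_seq.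
rewrite run_put // eval_sub layout_get // eval_const [nth _ _ _]/= subn1 [set_nth _ _ _ _]/=.
by rewrite run_put // eval_issues [set_nth _ _ _ _]/= (big_geq (leqnn n)).
Qed.

Lemma best_rec bs x : x < X -> top_raise bs x = improve m n q ht ow ct bs x (top_raise bs x.+1).
Proof. by move=> xX; rewrite /best /index_iota -(subnSK xX). Qed.

Lemma run_if e c d M : run (If e c d) M = if eval M e != 0 then run c M else run d M.
Proof. by []. Qed.

Lemma run_cell_end T bs x : x < X ->
  run cell_end (issue_state T x
    (top_raise bs x.+1).1.1 (top_raise bs x.+1).1.2 (top_raise bs x.+1).2 bs 0) =
  cell_state T bs x.
Proof.
move=> xX; rewrite /cell_state (best_rec _ xX) /improve; move: (top_raise bs x.+1) => t.
rewrite /issue_state /cell_end run_seq big_mkord -/(raise_gain bs x) run_if.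
rewrite eval_leq eval_add !eval_mul !layout_get // eval_const eval_expense layout_get //.
rewrite [nth _ _ _]/= ![nth _ _ _]/= addn1 eqb0 negbK; case: ifP => _.
  rewrite !run_seq run_put // layout_get // ![nth _ _ _]/= [set_nth _ _ _ _]/=.
  rewrite run_put // eval_expense layout_get // [nth _ _ _]/= [set_nth _ _ _ _]/=.
  by rewrite run_put // layout_get // [nth _ _ _]/= [set_nth _ _ _ _]/= run_put.
by rewrite run_put.
Qed.

(** [T] is the number of rounds left, as in register 2. *)
Definition round_budgets T := iter (X - T) table_step (fun=> 0).

Definition round_state T : memory :=
  lay r [:: m; q; T; 0; 0; 0; 0; 0; 0; 0; 0; 0] (round_budgets T).

Lemma run_round_start T : T < X ->
  run round_start (round_state T.+1) = cell_state T (round_budgets T.+1) X.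
Proof.
move=> TX; rewrite /round_state /round_start !run_seq /cell_state.
rewrite /best /index_iota subnn [foldr _ _ _]/=.
rewrite run_put // eval_sub layout_get // eval_const [nth _ _ _]/= subn1 [set_nth _ _ _ _]/=.
do 3!rewrite run_put // eval_const [set_nth _ _ _ _]/=.
by rewrite run_put // /cells_e !eval_mul layout_get // eval_add eval_issues eval_level eval_const.
Qed.

Lemma run_round_end T : T < X ->
  run round_end (cell_state T (round_budgets T.+1) 0) = round_state T.
Proof.
move=> TX; rewrite /cell_state /round_state {5}/round_budgets.
rewrite -(subnSK TX) iterS -/(round_budgets T.+1); move: (round_budgets _) => bs.
have [_ _] := bestP m n q (@height_mono r n k) X ow ct bs 0.
rewrite /greedy_step; move: (top_raise bs 0) => t tP.
rewrite /round_end run_seq run_if layout_get // [nth _ _ _]/=.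
have [t0|t0] := eqVneq t.1.1 0.
  by lazy delta [negb] iota beta; rewrite !run_seq !run_put.
have [tX _] := tP t0; lazy delta [negb] iota beta; rewrite !run_seq.
have -> M e e' : run (Write (Read 0 [+] 12 [+] e) e') M =
  update M (M 0 + 12 + eval M e) (eval M e') by [].
rewrite eval_content layout_get // layout0 eval_owner layout_get //.
by rewrite update_budget // !run_put.
Qed.

Hypothesis q_ltn : q < 2 ^ W.

Lemma ltn_pow x : x <= S -> x < 2 ^ W.
Proof.
move=> xS; apply: leq_ltn_trans xS _; apply: leq_trans (ltn_expl S (isT : 1 < 2)) _.
by rewrite leq_exp2l // /W; lia.
Qed.

Lemma ltn_powS x : x < 2 ^ S -> x < 2 ^ W.
Proof. by move=> xS; apply: leq_trans xS _; rewrite leq_exp2l // /W; lia. Qed.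

Let X_leq : X <= S. Proof. by apply: leq_trans B_leq; rewrite /B; lia. Qed.
Let Y_leq : Y <= S.
Proof.
apply: leq_trans X_leq; rewrite /cells -mulnA leq_mul2l; apply/orP; right.
by apply: leq_trans (leq_pmull _ n_gt0); lia.
Qed.
Let n_leq : n <= S. Proof. by apply: leq_trans B_leq; rewrite /B; lia. Qed.
Let m_leq : m <= S.
Proof. by apply: leq_trans Y_leq; rewrite leq_pmulr. Qed.
Let W_gt0 : 0 < W.
Proof. by rewrite /W; move: n_leq; lia. Qed.

Lemma bounded_lay vs bs : all (fun v => v < 2 ^ W) vs -> (forall i, bs i < 2 ^ S) ->
  bounded W (lay r vs bs).
Proof.
move=> hv hb; apply: bounded_layout => // [|x|x]; [exact: ltn_pow | |];
  exact: ltn_powS.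
Qed.

Lemma gain_leq bs x : raise_gain bs x <= X.
Proof.
apply: leq_trans (potential_height r m n k q (raise bs x)).
by apply: leq_sum => j _; apply: leq_subr.
Qed.

Lemma best_ltn bs x : (forall i, bs i < 2 ^ S) ->
  [/\ (top_raise bs x).1.1 < 2 ^ W, (top_raise bs x).1.2 < 2 ^ W & (top_raise bs x).2 < 2 ^ W].
Proof.
move=> hb; rewrite /best.
have : all (fun y => y < X) (index_iota x X).
  by apply/allP => y; rewrite mem_index_iota => /andP[].
elim: index_iota => [_|y l IH /= /andP[yX /IH[g1 c1 x1]]].
  by split; apply: ltn_pow => //; apply: leq_trans m_leq.
rewrite /improve; case: ifP => // _; split => /=.
- exact: ltn_pow (leq_trans (gain_leq _ _) X_leq).
- by apply: ltn_powS; apply: leq_ltn_trans (leq_subr _ _) (r_ltn _).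
- exact: ltn_pow (leq_trans (ltnW yX) X_leq).
Qed.

Lemma sum_pair_hit_leq j bs y : \sum_(y <= z < Y) pair_hit j bs z <= S.
Proof.
apply: leq_trans Y_leq; apply: (@leq_trans (\sum_(y <= z < Y) 1)).
  by apply: leq_sum => z _; apply: leq_b1.
by rewrite sum_nat_const_nat muln1 leq_subr.
Qed.

Lemma sum_gain_leq bs x j :
  \sum_(j <= i < n) (minn q (reached (raise bs x) i) - minn q (reached bs i)) <= S.
Proof.
apply: leq_trans X_leq; apply: leq_trans (gain_leq bs x).
have [jn|nj] := leqP j n; last by rewrite big_geq // ltnW.
rewrite /gain -(big_mkord xpredT (fun i =>
  minn q (reached (raise bs x) i) - minn q (reached bs i))).
by rewrite [X in _ <= X](big_cat_nat (n := j)) //= leq_addl.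
Qed.

Lemma runs_scan_loop T x j acc g c x' bs :
  T <= X -> x < X -> j < n -> acc <= S -> g < 2 ^ W -> c < 2 ^ W -> x' < 2 ^ W ->
  (forall i, bs i < 2 ^ S) ->
  bounded W (scan_state T x j acc g c x' bs 0) /\
  runs (While (get 5) scan) (scan_state T x j acc g c x' bs Y) (scan_loop S)
    (scan_state T x j acc g c x' bs 0).
Proof.
move=> TX xX jn accS gW cW xW hb.
have bnd y : y <= Y -> bounded W (scan_state T x j acc g c x' bs y).
  move=> yY; apply: bounded_lay => //=; rewrite q_ltn gW cW xW !ltn_pow ?sum_pair_hit_leq //.
  - exact: leq_trans yY _.
  - exact: leq_trans (ltnW jn) _.
  - exact: leq_trans (ltnW xX) _.
  - exact: leq_trans TX _.
split; first exact: bnd.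
apply: runs_while => // y yY; first by split; [apply: bnd | rewrite layout_get].
by apply: runs_code => //; [apply: bnd | apply: run_scan].
Qed.

Lemma runs_issue_loop T x g c x' bs :
  T <= X -> x < X -> g < 2 ^ W -> c < 2 ^ W -> x' < 2 ^ W ->
  (forall i, bs i < 2 ^ S) ->
  bounded W (issue_state T x g c x' bs 0) /\
  runs (While (get 4) issue) (issue_state T x g c x' bs n) (issue_loop S)
    (issue_state T x g c x' bs 0).
Proof.
move=> TX xX gW cW xW hb.
have bnd j : j <= n -> bounded W (issue_state T x g c x' bs j).
  move=> jn; apply: bounded_lay => //=; rewrite q_ltn gW cW xW !ltn_pow ?sum_gain_leq //.
  - exact: leq_trans jn _.
  - exact: leq_trans (ltnW xX) _.
  - exact: leq_trans TX _.
split; first exact: bnd.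
apply: runs_while => // j jn; first by split; [apply: bnd | rewrite layout_get].
have [bs0 loop] := @runs_scan_loop T x j _ g c x' bs TX xX jn (sum_gain_leq bs x j.+1) gW cW xW hb.
apply: runs_seq (runs_code (c := issue_start) isT W_gt0 (bnd _ jn)
  (run_issue_start _ _ _ _ _ _ jn)) _.
exact: runs_seq loop (runs_code (c := issue_end) isT W_gt0 bs0 (run_issue_end _ _ _ _ _ _ jn)).
Qed.

Lemma runs_cell_loop T bs : T <= X -> (forall i, bs i < 2 ^ S) ->
  bounded W (cell_state T bs 0) /\
  runs (While (get 3) cell) (cell_state T bs X) (cell_loop S) (cell_state T bs 0).
Proof.
move=> TX hb.
have bnd x : x <= X -> bounded W (cell_state T bs x).
  move=> xX; have [gW cW xW] := best_ltn x hb.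
  apply: bounded_lay => //=; rewrite q_ltn gW cW xW !ltn_pow //.
  - exact: leq_trans xX _.
  - exact: leq_trans TX _.
split; first exact: bnd.
apply: runs_while => // x xX; first by split; [apply: bnd | rewrite layout_get].
have [gW cW xW] := best_ltn x.+1 hb.
have [bs0 loop] := @runs_issue_loop T x _ _ _ bs TX xX gW cW xW hb.
apply: runs_seq (runs_code (c := cell_start) isT W_gt0 (bnd _ xX) (run_cell_start _ _ xX)) _.
exact: runs_seq loop (runs_code (c := cell_end) isT W_gt0 bs0 (run_cell_end _ _ xX)).
Qed.

(** Budgets are copied from the table and never accumulated, so they do not grow from round to
    round. *)
Lemma round_budgets_ltn T i : round_budgets T i < 2 ^ S.
Proof.
rewrite /round_budgets; elim: (X - T) i => [|N IH] i; first by rewrite expn_gt0.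
rewrite iterS /greedy_step; case: ifP => // _.
by rewrite /update; case: eqP => _; [apply: r_ltn | apply: IH].
Qed.

Lemma bounded_round T : T <= X -> bounded W (round_state T).
Proof.
move=> TX; apply: bounded_lay => [|i]; last exact: round_budgets_ltn.
by rewrite /= q_ltn !ltn_pow // (leq_trans TX).
Qed.

Lemma runs_round_loop :
  runs (While (get 2) round) (round_state X) (round_loop S) (round_state 0).
Proof.
apply: runs_while => // T TX.
  by split; [apply: bounded_round | rewrite layout_get].
have [bs0 loop] := runs_cell_loop (ltnW TX) (round_budgets_ltn T.+1).
apply: runs_seq (runs_code (c := round_start) isT W_gt0 (bounded_round TX) (run_round_start TX)) _.
exact: runs_seq loop (runs_code (c := round_end) isT W_gt0 bs0 (run_round_end TX)).
Qed.

Section Output.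
Variable bs : nat -> nat.
Hypothesis bs_ltn : forall i, bs i < 2 ^ S.

(** The input area when the voters above [i] have been written over it. *)
Definition output_input (i x : nat) : nat :=
  if i.+1.*2 <= x < m.*2 then (if odd x then 1 else n * bs x./2) else r x.

Definition output_state (i : nat) : memory :=
  lay (output_input i) [:: m; q; 0; i; 0; 0; 0; 0; 0; 0; 0; 0] bs.

(** The output stays below the base address, so writing it spares the registers and the budgets
    still to be read. *)
Lemma double_m_ltn : m.*2 < B.
Proof.
have : m * 2 <= X.
  by rewrite /cells -mulnA leq_mul2l; apply/orP; right; apply: leq_trans (leq_pmull _ n_gt0); lia.
by rewrite /B; lia.
Qed.

Lemma output_input_small i x : x < i.+1.*2 -> output_input i x = r x.
Proof. by rewrite /output_input ltnNge => /negbTE ->. Qed.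

Lemma run_output i : i < m.-1 -> run output (output_state i.+1) = output_state i.
Proof.
move=> im; have mB := double_m_ltn; rewrite /output_state /output !run_seq.
rewrite run_put // eval_sub layout_get // eval_const [nth _ _ _]/= subn1 [set_nth _ _ _ _]/=.
have runW M e e' : run (Write e e') M = update M (eval M e) (eval M e') by [].
rewrite [X in run _ X]runW !eval_add !layout_get // !eval_const [nth _ _ _]/=.
rewrite update_input //; last by lia.
rewrite runW !eval_add !layout_get // eval_mul /issues_e eval_read !eval_const.
rewrite layout_input // layout_budget // eval_add layout_get // eval_const [nth _ _ _]/=.
rewrite update_input //; last by lia.
congr layout; apply: funext => x; rewrite /update.
rewrite (_ : (1 == i + i + 3) = false); last by lia.
rewrite [output_input _ 1]output_input_small // r1; case: eqP => [->|x2].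
  rewrite /output_input ifT; last by lia.
  by rewrite (_ : i + i + 2 = (i + 1).*2) ?odd_double ?doubleK //; lia.
case: eqP => [->|x3].
  rewrite /output_input ifT; last by lia.
  by rewrite (_ : i + i + 3 = (i + 1).*2.+1) /= ?odd_double //; lia.
rewrite /output_input; congr (if _ then _ else _); lia.
Qed.

Lemma bounded_output i : i < m -> bounded W (output_state i).
Proof.
move=> im; apply: bounded_layout => [|x||j]; last exact: ltn_powS.
- exact: ltn_pow.
- rewrite /output_input; case: ifP => _; last exact: ltn_powS.
  case: ifP => _; first by rewrite ltn_pow // (leq_trans n_gt0).
  (* An output is a product of two numbers below [2 ^ S]. *)
  apply: (@leq_trans (2 ^ S * 2 ^ S)).
    by apply: ltn_mul => //; apply: leq_ltn_trans n_leq (ltn_expl _ _).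
  by rewrite -expnD leq_exp2l // /W; lia.
- by rewrite /= q_ltn !ltn_pow // (leq_trans (ltnW im)).
Qed.

Lemma runs_output_loop :
  runs (While (get 3) output) (output_state m.-1) (output_loop S) (output_state 0).
Proof.
have m1 : m.-1 <= S by apply: leq_trans m_leq; apply: leq_pred.
apply: runs_while => // i im.
  by split; [apply: bounded_output; lia | rewrite layout_get].
by apply: (runs_code (c := output) isT W_gt0 (bounded_output _) (run_output im)); lia.
Qed.

Lemma run_final i : i < m ->
  run final (output_state 0) i.*2 = n * bs i /\ run final (output_state 0) i.*2.+1 = 1.
Proof.
move=> im; have mB := double_m_ltn.
have E : eval (output_state 0) (issues_e [*] budget_e 0) = n * bs 0.
  rewrite /output_state eval_mul layout_budget // eval_const /issues_e eval_read eval_const.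
  by rewrite layout_input; [rewrite output_input_small // r1 | lia].
have -> : run final (output_state 0) =
  update (update (update (output_state 0) 1 (n * bs 0)) 0 (n * bs 0)) 1 1 by rewrite -E.
case: i im => [|i] im; first by rewrite /update.
rewrite /update doubleS /= /output_state !layout_input; try lia.
rewrite /output_input -doubleS; split; first by rewrite ifT ?odd_double ?doubleK //; lia.
by rewrite ifT /= ?odd_double //; lia.
Qed.

End Output.

Lemma run_init : r 0 = m -> (forall x, B <= x -> r x = 0) -> q = quota r m k ->
  run init r = round_state X.
Proof.
move=> r0 r_out qE; have mB := double_m_ltn.
have runW M e e' : run (Write e e') M = update M (eval M e) (eval M e') by [].
have len M : M 0 = m -> M 1 = n -> M 2 = k -> eval M length_e = B.
  move=> M0 M1 M2; rewrite /length_e /issues_e /level_e !(evalE, eval_read).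
  by rewrite M0 M1 M2.
rewrite /init !run_seq runW len // runW len //; try by rewrite /update ifN //; lia.
have -> : update (update r B (eval r (Read 0))) (eval (update r B (eval r (Read 0))) 0) B =
    lay r [:: m; 0; 0; 0; 0; 0; 0; 0; 0; 0; 0; 0] (fun=> 0).
  apply: funext => x; rewrite /layout /update !(eval_read, eval_const) r0.
  case: eqP => // x0; case: eqP => [->|xB].
    by rewrite ltnn ifT ?subnn //; lia.
  case: ltnP => // Bx; rewrite r_out //; case: ifP => // _.
  have : 0 < x - B by lia.
  by case: (x - B) => [|[|[|[|[|[|[|[|[|[|[|[|?]]]]]]]]]]]] //=; rewrite nth_nil.
rewrite run_put // eval_add eval_div !eval_mul eval_add eval_level layout_get // !eval_const.
rewrite !eval_read !eval_const !layout_input; try by rewrite /B; lia.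
rewrite [nth _ _ _]/= (addn1 k) -/(quota r m k) -qE [set_nth _ _ _ _]/=.
rewrite run_put // /cells_e !eval_mul layout_get // eval_add eval_issues eval_level eval_const.
by rewrite [set_nth _ _ _ _]/= /round_state /round_budgets subnn.
Qed.

Lemma runs_main : r 0 = m -> (forall x, B <= x -> r x = 0) -> q = quota r m k ->
  exists M : memory, runs main r (main_time S) M /\
    forall i, i < m -> M i.*2 = n * round_budgets 0 i /\ M i.*2.+1 = 1.
Proof.
move=> r0 r_out qE; pose bs := round_budgets 0.
have hb := round_budgets_ltn 0.
exists (run final (output_state bs 0)); split; last by move=> i; apply: run_final.
apply: runs_seq (runs_code (c := init) isT W_gt0 _ (run_init r0 r_out qE)) _.
  by move=> x; apply: ltn_powS.
apply: runs_seq runs_round_loop _.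
apply: runs_seq; last first.
  by apply: runs_seq (runs_output_loop hb) _; apply: runs_code => //; apply: bounded_output.
apply: runs_code => //; first exact: bounded_round.
rewrite /round_state run_put // eval_sub layout_get // eval_const [nth _ _ _]/= subn1.
rewrite /output_state [set_nth _ _ _ _]/=; congr layout.
by apply: funext => x; rewrite /output_input prednK // ifN //; lia.
Qed.

End Correct.

Lemma size_leq_input_size w : size w <= input_size w.
Proof. by rewrite -sum1_size; apply: leq_sum. Qed.

Lemma nth_ltn_input_size w x : nth 0 w x < 2 ^ input_size w.
Proof.
elim: w x => [|a w IH] [|x]; rewrite ?expn_gt0 //= /input_size big_cons expnD.
  by apply: leq_trans (ltn_bits a) _; rewrite leq_pmulr // expn_gt0.
by apply: leq_trans (IH x) _; rewrite leq_pmull // expn_gt0.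
Qed.

(** The quota exceeds a product of two numbers below [2 ^ s] by at most 1. *)
Lemma quota_ltn (r : nat -> nat) m k s : 0 < m -> k.+1 * m < 2 ^ s -> r 3 < 2 ^ s ->
  quota r m k < 2 ^ (4 * s).
Proof.
move=> m_gt0 km r3; rewrite /quota addn1.
apply: (@leq_ltn_trans (r 3 * (k.+1 * m)).+1); first by rewrite ltnS leq_div.
have -> : 2 ^ (4 * s) = 2 ^ s * 2 ^ s * (2 ^ s * 2 ^ s).
  by rewrite -!expnD; congr (2 ^ _); lia.
have v_gt0 : 0 < k.+1 * m by rewrite muln_gt0.
move: (2 ^ s) (k.+1 * m) km r3 v_gt0 => u v vu ru v_gt0.
have : r 3 * v <= u.-1 * u.-1 by apply: leq_mul; lia.
have : u * u <= u * u * (u * u) by rewrite leq_pmulr // muln_gt0; lia.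
by nia.
Qed.

Local Open Scope ring_scope.

Theorem theorem6p4 (R : realType) :
  exists (algo : program) (A e : nat), forall I : instance,
    exists (time : nat) (M : memory),
      [/\ exec algo (input_memory (encode I)) time M,
          (time <= A * input_size (encode I) ^ e)%N
        & forall d : 'I_(voters I) -> R, winning_bribery I d ->
            winning_bribery I (output_bribery R I M) /\
            bribery_cost I (output_bribery R I M)
              <= (ln (cover_number I)%:R + 1) * bribery_cost I d].
Proof.
have [A [e timeP]] := poly_bounded_main_time.
exists main, A, e => I; set w := encode I.
pose m := voters I; pose n := issues I; pose k := level I.
pose q := quota (nth 0%N w) m k.
have sz : (5 + n + cells m n k <= input_size w)%N.
  by rewrite -size_encode size_leq_input_size.
have m0 : (0 < m)%N := voters_gt0 I.
have n0 : (0 < n)%N := issues_gt0 I.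
have km : (k.+1 * m < 2 ^ input_size w)%N.
  apply: leq_ltn_trans (ltn_expl _ (isT : (1 < 2)%N)); apply: leq_trans sz.
  by rewrite /cells; nia.
have q_lt := quota_ltn m0 km (nth_ltn_input_size w 3).
have [|M [[time exec_time time_leq] out]] := @runs_main m n k (input_size w) (nth 0%N w)
  m0 n0 erefl erefl sz (nth_ltn_input_size w) q q_lt erefl _ erefl.
  by move=> x x_ge; rewrite nth_default // size_encode.
exists time, M; split=> //.
  by apply: leq_trans time_leq (timeP _ _); apply: leq_trans sz.
move=> d /greedy_bribery.
suff -> : output_bribery R I M = fun i => (n * greedy_budgets I i)%:R by [].
apply: funext => i; rewrite /output_bribery.
have [-> ->] := out _ (ltn_ord i).
by rewrite divr1 /round_budgets subn0.
Qed.
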